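(* Let $A=\{a_k\}_{k\in\mathbb{Z}}$ and $B=\{b_k\}_{k\in\mathbb{Z}}$ be sequences of complex numbers with $a_k=o(k^{\alpha})$ and $b_k=o(k^{\beta})$ as $k\to\pm\infty$ for some $\alpha,\beta<1$. For positive integers $p$ and $q>1$, $$\begin{aligned} &(-1)^{p+q}\sum_{n=1}^\infty\frac{\bar M^{(B)}_n(p)}{n^q}a_n+\sum_{n=1}^\infty\frac{M^{(B)}_n(p)}{n^q}a_n\\ &=(-1)^p\sum_{j=1}^p\binom{p+q-j-1}{q-1}\sum_{n=1}^\infty\frac{R^{(A)}_n(j)}{n^{p+q-j}}b_n\\ &\quad+(-1)^p\,2\sum_{j=1}^{[q/2]}\binom{p+q-2j-1}{p-1}D^{(A)}(2j)D^{(B)}(p+q-2j)\\ &\quad+b_0\bigl(1+(-1)^{p+q}\bigr)D^{(A)}(p+q)-(-1)^pa_0\binom{p+q-1}{q}D^{(B)}(p+q)\\ &\quad-(-1)^p\binom{p+q-1}{p}D^{(AB)}(p+q). \end{aligned}$$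
   Context: Growth conditions such as $a_k=o(k^\alpha)$ are understood with $|k|^\alpha$ for negative $k$. $[x]$ is the integer part of $x$. For a sequence $A=\{a_k\}$ (and likewise for $B=\{b_k\}$) and integers $j\ge1$, $n\ge0$: $D^{(A)}(j):=\sum_{k=1}^\infty\frac{a_k}{k^j}$ for $j>1$, and $D^{(A)}(1):=0$ by convention; $E^{(A)}_n(j):=\sum_{k=1}^n \frac{a_{n-k}}{k^j}$, $E^{(A)}_0(j):=0$; $\bar E^{(A)}_n(j):=\sum_{k=1}^n \frac{a_{k-n-1}}{k^j}$, $\bar E^{(A)}_0(j):=0$; $F^{(A)}_n(1):=\sum_{k=1}^\infty\frac{a_{k+n}-a_k}{k}$, $F^{(A)}_n(j):=\sum_{k=1}^\infty\frac{a_{k+n}}{k^j}$ for $j>1$; $\bar F^{(A)}_n(1):=\sum_{k=1}^\infty\frac{a_{k-n}-a_k}{k}$, $\bar F^{(A)}_n(j):=\sum_{k=1}^\infty\frac{a_{k-n}}{k^j}$ for $j>1$; $G^{(A)}_n(j):=E^{(A)}_n(j)-\bar E^{(A)}_{n-1}(j)-\frac{a_0}{n^j}$ for $n\ge1$, $G^{(A)}_0(j):=0$; $L^{(A)}_n(j):=F^{(A)}_n(j)+(-1)^j\bar F^{(A)}_n(j)$; $M^{(A)}_n(j):=E^{(A)}_n(j)+(-1)^jF^{(A)}_n(j)$; $\bar M^{(A)}_n(j):=\bar F^{(A)}_n(j)-\bar E^{(A)}_{n-1}(j)$ for $n\ge1$; $R^{(A)}_n(j):=G^{(A)}_n(j)+(-1)^jL^{(A)}_n(j)$.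 Also $D^{(AB)}(q):=\sum_{n=1}^\infty\frac{a_nb_n}{n^q}$.
   Formalization: The added condition α+β<q−1 (automatic for q≥3, so it reads α+β<1 when q=2) is assumed, since for q=2 and α+β≥1 the series on the left can diverge. *)

(* Defs.v *)
From Stdlib Require Import Reals ZArith.
From Coquelicot Require Import Coquelicot.

Open Scope C_scope.

(* a_k = o(|k|^alpha) as k tends to +oo and to -oo.  [Rpower (INR k) alpha] is
   the usual power for k >= 1, and only large k matter here. *)
Definition little_o_pow (a : Z -> C) (alpha : R) : Prop :=
  is_domin eventually
    (fun k : nat => Rpower (INR k) alpha) (fun k : nat => a (Z.of_nat k)) /\
  is_domin eventually
    (fun k : nat => Rpower (INR k) alpha) (fun k : nat => a (- Z.of_nat k)%Z).

(* u 1 + u 2 + u 3 + ..., the limit of the partial sums taken in this order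
   (the term u 0 is not used).  [Cseries1] is total and is meaningful only when
   [cv_series1] holds; Coquelicot's [Series] exists for real series only. *)
Definition Cseries1 (u : nat -> C) : C :=
  (Series (fun n => Re (u (S n))), Series (fun n => Im (u (S n)))).

Definition cv_series1 (u : nat -> C) : Prop :=
  ex_series (fun n => u (S n)).

Definition Cpown (n j : nat) : C := RtoC (INR n) ^ j.

Definition Cbinom (n k : nat) : C := RtoC (Binomial.C n k).

Definition Csign (n : nat) : C := RtoC (-1) ^ n.

Definition Dterm (a : Z -> C) (j k : nat) : C :=
  a (Z.of_nat k) / Cpown k j.

Definition Dsum (a : Z -> C) (j : nat) : C :=
  if Nat.eqb j 1 then 0 else Cseries1 (Dterm a j).

Definition Esum (a : Z -> C) (n j : nat) : C :=
  sum_n_m (fun k => a (Z.of_nat n - Z.of_nat k)%Z / Cpown k j) 1 n.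

Definition Ebar (a : Z -> C) (n j : nat) : C :=
  sum_n_m (fun k => a (Z.of_nat k - Z.of_nat n - 1)%Z / Cpown k j) 1 n.

Definition Fterm (a : Z -> C) (n j k : nat) : C :=
  if Nat.eqb j 1
  then (a (Z.of_nat k + Z.of_nat n)%Z - a (Z.of_nat k)) / Cpown k 1
  else a (Z.of_nat k + Z.of_nat n)%Z / Cpown k j.

Definition Fsum (a : Z -> C) (n j : nat) : C := Cseries1 (Fterm a n j).

Definition Fbarterm (a : Z -> C) (n j k : nat) : C :=
  if Nat.eqb j 1
  then (a (Z.of_nat k - Z.of_nat n)%Z - a (Z.of_nat k)) / Cpown k 1
  else a (Z.of_nat k - Z.of_nat n)%Z / Cpown k j.

Definition Fbar (a : Z -> C) (n j : nat) : C := Cseries1 (Fbarterm a n j).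

Definition Gsum (a : Z -> C) (n j : nat) : C :=
  if Nat.eqb n 0 then 0
  else Esum a n j - Ebar a (n - 1) j - a 0%Z / Cpown n j.

Definition Lsum (a : Z -> C) (n j : nat) : C :=
  Fsum a n j + Csign j * Fbar a n j.

Definition Msum (a : Z -> C) (n j : nat) : C :=
  Esum a n j + Csign j * Fsum a n j.

(* Used for n >= 1 only. *)
Definition Mbar (a : Z -> C) (n j : nat) : C :=
  Fbar a n j - Ebar a (n - 1) j.

Definition Rsum (a : Z -> C) (n j : nat) : C :=
  Gsum a n j + Csign j * Lsum a n j.

(* The infinite series in the definitions of D, F and Fbar converge. *)
Definition sums_defined (a : Z -> C) : Prop :=
  (forall j : nat, (1 < j)%nat -> cv_series1 (Dterm a j)) /\
  (forall n j : nat, (1 <= j)%nat ->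
     cv_series1 (Fterm a n j) /\ cv_series1 (Fbarterm a n j)).

(* Main.v *)
Require Import Defs.
From Stdlib Require Import Reals ZArith Lra Lia.
From Coquelicot Require Import Coquelicot.

Open Scope C_scope.

(** Only the values at nonnegative indices matter: shifting indices turns
    [Mbar b n p] and [Msum b n p] into [b 0 / n ^ p] plus the sums over [x >= 1]
    of [b x / (n + x) ^ p] and of [b x / (n - x) ^ p] ([x <> n]), with an extra
    [- b x / x], respectively [+ b x / x], when [p = 1]; and
    [Rsum a n j = Msum a n j + Mbar a n j - a 0 / n ^ j].  The formula then holds
    coefficientwise in [a k * b m]: this is the partial fraction expansion of
    [1 / (u ^ p * v ^ q)] in terms of [u + v], taken at [(u, v) = (m - k, k)] and
    at [(m + k, - k)], where adding the two keeps only the even powers of [1 / k].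
    All double series are dominated, because [x ^ f] times a kernel is at most a
    multiple of [n ^ (f + d) * (x ^ (- 1 - d) + |n - x| ^ (- 1 - d))].  Hence each
    one is the limit of its sums over the squares [k, m <= K], which do not depend
    on the order of summation, and the coefficientwise identity passes to the
    limit. *)

(** * Limits and sums of complex sequences *)

(** The case [p = 1] shapes the estimates. Against a sequence growing like [x ^ f] with [0 < f < 1],
    the kernel [1 / (n + x)] alone is not summable, but subtracting [1 / x] gains a factor [n / x],
    and the resulting bound serves every [p]. The inner sum at [n] is then of size [n ^ (f + d)], so
    with [a n] of size [n ^ e] the outer series converges absolutely once [e + f + 2 * d <= q - 1].
    This is where [alpha + beta < q - 1] enters; for [q >= 3] it already follows from
    [alpha, beta < 1].

    Two degenerate cases of the partial fractions explain the remaining terms. At [m = k] one of the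
    two expansions has [u = 0]: the kernels omit the singular terms, and what is left is a
    hockey-stick sum, the coefficient of the diagonal series of [a k * b k]. For [p = 1] and even
    [q] the expansion contains a multiple of [1 / (k ^ q * m)], whose sum against [b m] may diverge;
    the [1 / x] in the kernels cancels exactly this term, in agreement with the convention
    [D(1) = 0]. *)

Notation sum1 u n := (@sum_n_m C_AbelianMonoid u 1 n : C).
Notation Rsum1 u n := (@sum_n_m R_AbelianMonoid u 1 n : R).

Lemma sum1_0 (u : nat -> C) : sum1 u 0 = 0.
Proof. now rewrite sum_n_m_zero by lia. Qed.

Lemma sum1_S (u : nat -> C) (n : nat) :
  sum1 u (S n) = sum1 u n + u (S n).
Proof. now rewrite sum_n_Sm by lia. Qed.

Lemma Rsum1_0 (u : nat -> R) : Rsum1 u 0 = 0%R.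
Proof. now rewrite sum_n_m_zero by lia. Qed.

Lemma Rsum1_S (u : nat -> R) (n : nat) :
  Rsum1 u (S n) = (Rsum1 u n + u (S n))%R.
Proof. now rewrite sum_n_Sm by lia. Qed.

Lemma sum1_ext (u v : nat -> C) (n : nat) :
  (forall k, (1 <= k <= n)%nat -> u k = v k) ->
  sum1 u n = sum1 v n.
Proof. intros H. apply sum_n_m_ext_loc. exact H. Qed.

Lemma Rsum1_ext (u v : nat -> R) (n : nat) :
  (forall k, (1 <= k <= n)%nat -> u k = v k) -> Rsum1 u n = Rsum1 v n.
Proof. intros H. apply sum_n_m_ext_loc. exact H. Qed.

Lemma sum1_plus (u v : nat -> C) (n : nat) :
  sum1 (fun k => u k + v k) n = sum1 u n + sum1 v n.
Proof.
  induction n as [|n IH]; [rewrite !sum1_0 | rewrite !sum1_S, IH]; ring.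
Qed.

Lemma sum1_mult_l (c : C) (u : nat -> C) (n : nat) :
  sum1 (fun k => c * u k) n = c * sum1 u n.
Proof.
  induction n as [|n IH]; [rewrite !sum1_0 | rewrite !sum1_S, IH]; ring.
Qed.

Lemma sum1_swap (f : nat -> nat -> C) (m n : nat) :
  sum1 (fun i => sum1 (f i) n) m =
  sum1 (fun j => sum1 (fun i => f i j) m) n.
Proof.
  induction m as [|m IH].
  - rewrite sum1_0. symmetry. induction n as [|n IHn].
    + apply sum1_0.
    + rewrite sum1_S, IHn, sum1_0. ring.
  - rewrite sum1_S, IH, <- sum1_plus. apply sum1_ext. intros k _.
    now rewrite sum1_S.
Qed.

Lemma RtoC_sum1 (u : nat -> R) (n : nat) :
  RtoC (Rsum1 u n) = sum1 (fun k => RtoC (u k)) n.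
Proof.
  induction n as [|n IH].
  - now rewrite Rsum1_0, sum1_0.
  - now rewrite Rsum1_S, sum1_S, <- IH, RtoC_plus.
Qed.

Lemma Cmod_sum1 (u : nat -> C) (n : nat) :
  (Cmod (sum1 u n) <= Rsum1 (fun k => Cmod (u k)) n)%R.
Proof.
  induction n as [|n IH].
  - rewrite sum1_0, Rsum1_0, Cmod_0. lra.
  - rewrite sum1_S, Rsum1_S.
    eapply Rle_trans; [apply Cmod_triangle|]. lra.
Qed.

Lemma Rsum1_le (u v : nat -> R) (n : nat) :
  (forall k, (1 <= k <= n)%nat -> (u k <= v k)%R) ->
  (Rsum1 u n <= Rsum1 v n)%R.
Proof.
  induction n as [|n IH]; intros H.
  - rewrite !Rsum1_0. lra.
  - rewrite !Rsum1_S.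
    assert (Rsum1 u n <= Rsum1 v n)%R by (apply IH; intros; apply H; lia).
    assert (u (S n) <= v (S n))%R by (apply H; lia). lra.
Qed.

Lemma Rsum1_mult_l (c : R) (u : nat -> R) (n : nat) :
  Rsum1 (fun k => (c * u k)%R) n = (c * Rsum1 u n)%R.
Proof.
  induction n as [|n IH]; [rewrite !Rsum1_0 | rewrite !Rsum1_S, IH]; ring.
Qed.

Lemma Rsum1_plus (u v : nat -> R) (n : nat) :
  Rsum1 (fun k => (u k + v k)%R) n = (Rsum1 u n + Rsum1 v n)%R.
Proof.
  induction n as [|n IH]; [rewrite !Rsum1_0 | rewrite !Rsum1_S, IH]; ring.
Qed.

(** Stated through the real sequence of moduli, so that the squeeze and arithmetic rules for real
    limits apply directly. *)
Definition Clim (u : nat -> C) (l : C) : Prop :=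
  is_lim_seq (fun n => Cmod (u n - l)) 0.

Lemma Clim_squeeze (u : nat -> C) (l : C) (e : nat -> R) :
  (forall n, (Cmod (u n - l) <= e n)%R) -> is_lim_seq e 0 -> Clim u l.
Proof.
  intros H He. apply is_lim_seq_le_le with (fun _ => 0%R) e; trivial.
  - intros n. split; [apply Cmod_ge_0 | apply H].
  - apply is_lim_seq_const.
Qed.

Lemma Clim_ext (u v : nat -> C) (l : C) :
  (forall n, u n = v n) -> Clim u l -> Clim v l.
Proof.
  intros H. apply is_lim_seq_ext. intros n. now rewrite H.
Qed.

Lemma Clim_const (l : C) : Clim (fun _ => l) l.
Proof.
  apply Clim_squeeze with (fun _ => 0%R).
  - intros _. replace (l - l) with (RtoC 0) by ring. rewrite Cmod_0. lra.
  - apply is_lim_seq_const.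
Qed.

Lemma Clim_plus (u v : nat -> C) (l m : C) :
  Clim u l -> Clim v m -> Clim (fun n => u n + v n) (l + m).
Proof.
  intros Hu Hv.
  apply Clim_squeeze with (fun n => (Cmod (u n - l) + Cmod (v n - m))%R).
  - intros n. replace (u n + v n - (l + m)) with ((u n - l) + (v n - m)) by ring.
    apply Cmod_triangle.
  - replace (Finite 0) with (Finite (0 + 0)) by (f_equal; ring).
    now apply is_lim_seq_plus'.
Qed.

Lemma Clim_mult (u v : nat -> C) (l m : C) :
  Clim u l -> Clim v m -> Clim (fun n => u n * v n) (l * m).
Proof.
  intros Hu Hv.
  apply Clim_squeeze with
    (fun n => (Cmod (u n - l) * Cmod (v n - m) + Cmod (u n - l) * Cmod m
               + Cmod l * Cmod (v n - m))%R).
  - intros n.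
    replace (u n * v n - l * m) with
      ((u n - l) * (v n - m) + (u n - l) * m + l * (v n - m)) by ring.
    rewrite <- !Cmod_mult.
    eapply Rle_trans; [apply Cmod_triangle|]. apply Rplus_le_compat_r.
    apply Cmod_triangle.
  - replace (Finite 0) with (Finite (0 * 0 + 0 * Cmod m + Cmod l * 0))
      by (f_equal; ring).
    repeat apply is_lim_seq_plus'; apply is_lim_seq_mult'; trivial;
      apply is_lim_seq_const.
Qed.

Lemma Clim_scal (c : C) (u : nat -> C) (l : C) :
  Clim u l -> Clim (fun n => c * u n) (c * l).
Proof. intros H. apply Clim_mult; [apply Clim_const | exact H]. Qed.

Lemma Clim_minus (u v : nat -> C) (l m : C) :
  Clim u l -> Clim v m -> Clim (fun n => u n - v n) (l - m).
Proof.
  intros Hu Hv. replace (l - m) with (l + (-1) * m) by ring.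
  apply Clim_ext with (fun n => u n + (-1) * v n); [intros n; ring|].
  apply Clim_plus; trivial. now apply Clim_scal.
Qed.

Lemma Clim_unique (u : nat -> C) (l m : C) : Clim u l -> Clim u m -> l = m.
Proof.
  intros Hl Hm.
  assert (H : Clim (fun _ => 0) (l - m)).
  { replace (l - m) with ((-1) * (m - l)) by ring.
    apply Clim_ext with (fun n => (-1) * (u n - u n)); [intros; ring|].
    apply Clim_scal. now apply Clim_minus. }
  apply is_lim_seq_unique in H. rewrite Lim_seq_const in H.
  injection H as H.
  replace (0 - (l - m)) with (m - l) in H by ring. apply Cmod_eq_0 in H.
  replace l with (m - (m - l)) by ring. rewrite H. ring.
Qed.

Lemma Clim_shift (u : nat -> C) (l : C) (N : nat) :
  Clim u l <-> Clim (fun n => u (n + N)%nat) l.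
Proof. apply (is_lim_seq_incr_n (fun n => Cmod (u n - l))). Qed.

Lemma Clim_bound (u : nat -> C) (l : C) (M : R) :
  (forall n, (Cmod (u n) <= M)%R) -> Clim u l -> (Cmod l <= M)%R.
Proof.
  intros H Hu.
  apply Rnot_lt_le. intros Hlt.
  apply is_lim_seq_spec in Hu.
  assert (Hp : (0 < Cmod l - M)%R) by lra.
  destruct (Hu (mkposreal _ Hp)) as [N HN].
  specialize (HN N (le_n _)). simpl in HN.
  rewrite Rminus_0_r, Rabs_pos_eq in HN by apply Cmod_ge_0.
  assert (Cmod l <= Cmod (u N - l) + Cmod (u N))%R; [|specialize (H N); lra].
  rewrite <- (Cmod_opp (u N - l)).
  replace l with (- (u N - l) + u N) at 1 by ring. apply Cmod_triangle.
Qed.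

Lemma Clim_sum1 (f : nat -> nat -> C) (l : nat -> C) (p : nat) :
  (forall j, (1 <= j <= p)%nat -> Clim (f j) (l j)) ->
  Clim (fun K => sum1 (fun j => f j K) p) (sum1 l p).
Proof.
  induction p as [|p IH]; intros H.
  - rewrite sum1_0. apply Clim_ext with (fun _ => 0); [|apply Clim_const].
    intros. now rewrite sum1_0.
  - rewrite sum1_S.
    apply Clim_ext with (fun K => sum1 (fun j => f j K) p + f (S p) K).
    + intros. now rewrite sum1_S.
    + apply Clim_plus; [apply IH; intros; apply H; lia | apply H; lia].
Qed.

(** [Cseries1] is total and says nothing about convergence; [has_sum] carries the value and the
    convergence together, and [has_sum_Cseries1] and [has_sum_cv] recover the two separately. *)
Definition has_sum (u : nat -> C) (l : C) : Prop :=
  Clim (fun K => sum1 u K) l.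

Lemma has_sum_ext (u v : nat -> C) (l : C) :
  (forall n, (1 <= n)%nat -> u n = v n) -> has_sum u l -> has_sum v l.
Proof.
  intros H. apply Clim_ext. intros n. apply sum1_ext. intros k Hk. apply H. lia.
Qed.

Lemma has_sum_plus (u v : nat -> C) (l m : C) :
  has_sum u l -> has_sum v m -> has_sum (fun k => u k + v k) (l + m).
Proof.
  intros Hu Hv. eapply Clim_ext; [|exact (Clim_plus _ _ _ _ Hu Hv)].
  intros n. cbv beta. now rewrite sum1_plus.
Qed.

Lemma has_sum_scal (c : C) (u : nat -> C) (l : C) :
  has_sum u l -> has_sum (fun k => c * u k) (c * l).
Proof.
  intros Hu. eapply Clim_ext; [|exact (Clim_scal c _ _ Hu)].
  intros n. cbv beta. now rewrite sum1_mult_l.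
Qed.

Lemma has_sum_is_series (u : nat -> C) (l : C) :
  has_sum u l <-> is_series (fun n => u (S n)) l.
Proof.
  unfold has_sum. rewrite (Clim_shift _ _ 1).
  assert (E : forall n, sum_n (fun n => u (S n)) n = sum1 u (n + 1)).
  { intros n. rewrite Nat.add_1_r. apply sum_n_m_S. }
  split; intros H.
  - apply filterlim_locally_ball_norm. intros eps.
    apply is_lim_seq_spec in H. destruct (H eps) as [N HN]. exists N.
    intros n Hn. specialize (HN n Hn). unfold ball_norm.
    rewrite E. rewrite Rminus_0_r, Rabs_pos_eq in HN by apply Cmod_ge_0.
    exact HN.
  - assert (H' := proj1 (filterlim_locally_ball_norm _ _) H). clear H. rename H' into H.
    apply is_lim_seq_spec. intros eps. destruct (H eps) as [N HN]. exists N.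
    intros n Hn. specialize (HN n Hn). unfold ball_norm in HN.
    rewrite E in HN. rewrite Rminus_0_r, Rabs_pos_eq by apply Cmod_ge_0.
    exact HN.
Qed.

Lemma has_sum_cv (u : nat -> C) (l : C) : has_sum u l -> cv_series1 u.
Proof. intros H. exists l. now apply has_sum_is_series. Qed.

Lemma Re_sum1 (u : nat -> C) (n : nat) :
  Re (sum1 u n) = Rsum1 (fun k => Re (u k)) n.
Proof.
  induction n as [|n IH].
  - now rewrite sum1_0, Rsum1_0.
  - now rewrite sum1_S, Rsum1_S, <- IH.
Qed.

Lemma Im_sum1 (u : nat -> C) (n : nat) :
  Im (sum1 u n) = Rsum1 (fun k => Im (u k)) n.
Proof.
  induction n as [|n IH].
  - now rewrite sum1_0, Rsum1_0.
  - now rewrite sum1_S, Rsum1_S, <- IH.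
Qed.

Lemma has_sum_Cseries1 (u : nat -> C) (l : C) : has_sum u l -> Cseries1 u = l.
Proof.
  intros H. apply (Clim_shift _ _ 1) in H.
  (* One argument for [Re] and [Im]: both are additive, bounded by the modulus and commute with
     finite sums. *)
  assert (Hgen : forall (f : C -> R), (forall x y, f (x - y) = (f x - f y)%R) ->
    (forall x, (Rabs (f x) <= Cmod x)%R) ->
    (forall n, f (sum1 u n) = Rsum1 (fun k => f (u k)) n) ->
    Series (fun n => f (u (S n))) = f l).
  { intros f Hm Hb Hs. apply is_series_unique.
    change (is_lim_seq (sum_n (fun n => f (u (S n)))) (f l)).
    apply is_lim_seq_ext with (fun n => ((f (sum1 u (n + 1)) - f l) + f l)%R).
    { intros n. rewrite Hs, Nat.add_1_r.
      transitivity (Rsum1 (fun k => f (u k)) (S n)); [ring|].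
      symmetry. apply (sum_n_m_S (fun k => f (u k))). }
    replace (Finite (f l)) with (Finite (0 + f l)) by (f_equal; ring).
    apply is_lim_seq_plus'; [|apply is_lim_seq_const].
    apply is_lim_seq_abs_0.
    apply is_lim_seq_le_le with (fun _ => 0%R) (fun n => Cmod (sum1 u (n + 1) - l)).
    - intros n. rewrite <- Hm. split; [apply Rabs_pos | apply Hb].
    - apply is_lim_seq_const.
    - exact H. }
  unfold Cseries1. rewrite (Hgen Re), (Hgen Im).
  - now destruct l.
  - intros [] []; reflexivity.
  - intros x. eapply Rle_trans; [|apply Rmax_Cmod]. apply Rmax_r.
  - apply Im_sum1.
  - intros [] []; reflexivity.
  - intros x. eapply Rle_trans; [|apply Rmax_Cmod]. apply Rmax_l.
  - apply Re_sum1.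
Qed.

(** * Absolute convergence and limits over squares *)

Definition bounded_sums (g : nat -> R) : Prop :=
  exists M : R, forall K, (Rsum1 g K <= M)%R.

Lemma bounded_sums_ex_series (g : nat -> R) :
  (forall k, (1 <= k)%nat -> (0 <= g k)%R) -> bounded_sums g ->
  ex_series (fun n => g (S n)).
Proof.
  intros Hpos [M HM].
  assert (E : forall n, sum_n (fun n => g (S n)) n = Rsum1 g (S n)).
  { intros n. apply sum_n_m_S. }
  destruct (ex_finite_lim_seq_incr (sum_n (fun n => g (S n))) M) as [l Hl].
  - intros n. rewrite !E, (Rsum1_S g (S n)).
    specialize (Hpos (S (S n)) ltac:(lia)). lra.
  - intros n. rewrite E. apply HM.
  - exists l. exact Hl.
Qed.

Lemma has_sum_dominated (u : nat -> C) (g : nat -> R) :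
  (forall k, (1 <= k)%nat -> (Cmod (u k) <= g k)%R) -> bounded_sums g ->
  exists l, has_sum u l.
Proof.
  intros H Hg.
  assert (ex_series (fun n => u (S n))) as [l Hl].
  { apply (ex_series_le (V := C_CompleteNormedModule)) with (fun n => g (S n)).
    - intros n. apply H. lia.
    - apply bounded_sums_ex_series; trivial.
      intros k Hk. eapply Rle_trans; [apply Cmod_ge_0 | now apply H]. }
  exists l. now apply has_sum_is_series.
Qed.

Lemma bounded_sums_le (u g : nat -> R) (c : R) :
  (0 <= c)%R -> (forall k, (1 <= k)%nat -> (u k <= c * g k)%R) ->
  bounded_sums g -> bounded_sums u.
Proof.
  intros Hc H [M HM]. exists (c * M)%R. intros K.
  apply Rle_trans with (Rsum1 (fun k => (c * g k)%R) K).
  - apply Rsum1_le. intros k Hk. apply H. lia.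
  - rewrite Rsum1_mult_l. now apply Rmult_le_compat_l.
Qed.

(* Tannery's theorem for the truncated rows of [f]: row [k] misses its limit
   by at most [2 * g k], so only the rows of a finite part matter. *)
Lemma square_sums_limit (f : nat -> nat -> C) (s : nat -> C) (g : nat -> R)
    (l : C) :
  (forall k, (1 <= k)%nat -> has_sum (f k) (s k)) ->
  (forall k K, (1 <= k)%nat ->
     (Rsum1 (fun m => Cmod (f k m)) K <= g k)%R) ->
  bounded_sums g -> has_sum s l ->
  Clim (fun K => sum1 (fun k => sum1 (f k) K) K) l.
Proof.
  intros Hf Hg Hb Hs.
  assert (Hg0 : forall k, (1 <= k)%nat -> (0 <= g k)%R).
  { intros k Hk. specialize (Hg k 0%nat Hk). now rewrite Rsum1_0 in Hg. }
  assert (Hfg : forall k K, (1 <= k)%nat -> (Cmod (sum1 (f k) K) <= g k)%R).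
  { intros k K Hk. eapply Rle_trans; [apply Cmod_sum1 | now apply Hg]. }
  set (e := fun k K => Cmod (sum1 (f k) K - s k)).
  assert (He : forall k K, (1 <= k)%nat -> (e k K <= 2 * g k)%R).
  { intros k K Hk. unfold e.
    assert (Cmod (s k) <= g k)%R by (eapply Clim_bound; [|apply Hf; exact Hk]; auto).
    eapply Rle_trans; [apply Cmod_triangle|]. rewrite Cmod_opp.
    specialize (Hfg k K Hk). lra. }
  assert (Hlim : is_lim_seq (fun K => Rsum1 (fun k => e k K) K) 0).
  { apply is_lim_seq_spec. intros eps.
    assert (Hcau := bounded_sums_ex_series g Hg0 Hb).
    (* Budget: the rows after [N] cost at most twice a tail below [eps / 4], the first [N] rows less
       than [eps / 2]. The tail is a difference of two partial sums, each within [eps / 8] of the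
       limit. *)
    assert (exists N, forall K, (N <= K)%nat ->
              (Rsum1 g K - Rsum1 g N < eps / 4)%R) as [N HN].
    { destruct Hcau as [t Ht].
      assert (Ht' : is_lim_seq (fun n => Rsum1 g (S n)) t).
      { eapply is_lim_seq_ext; [|exact Ht]. intros n. apply sum_n_m_S. }
      apply (is_lim_seq_incr_1 (fun n => Rsum1 g n)) in Ht'.
      apply is_lim_seq_spec in Ht'.
      assert (H8 : (0 < eps / 8)%R) by (destruct eps; simpl; lra).
      destruct (Ht' (mkposreal _ H8)) as [N HN]. exists N. intros K HK.
      assert (H1 := HN K HK). assert (H2 := HN N (le_n _)). simpl in H1, H2.
      apply Rabs_def2 in H1. apply Rabs_def2 in H2. lra. }
    assert (Hfin : is_lim_seq (fun K => Rsum1 (fun k => e k K) N) 0).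
    { clear HN. induction N as [|N IH].
      - apply is_lim_seq_ext with (fun _ => 0%R); [|apply is_lim_seq_const].
        intros. now rewrite Rsum1_0.
      - apply is_lim_seq_ext with (fun K => (Rsum1 (fun k => e k K) N + e (S N) K)%R).
        + intros. now rewrite Rsum1_S.
        + replace (Finite 0) with (Finite (0 + 0)) by (f_equal; ring).
          apply is_lim_seq_plus'; trivial. apply Hf. lia. }
    apply is_lim_seq_spec in Hfin.
    assert (H2 : (0 < eps / 2)%R) by (destruct eps; simpl; lra).
    destruct (Hfin (mkposreal _ H2)) as [N' HN'].
    exists (max N N'). intros K HK. specialize (HN' K ltac:(lia)).
    simpl in HN'. rewrite Rminus_0_r in HN' |- *.
    apply Rabs_def2 in HN'.
    assert (Htail : (Rsum1 (fun k => e k K) K <= Rsum1 (fun k => e k K) N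
              + 2 * (Rsum1 g K - Rsum1 g N))%R).
    { assert (HK2 : (N <= K)%nat) by lia. revert HK2.
      (* The induction is on the number of rows only; the truncation [K] inside each row stays
         fixed. *)
      generalize K at 1 3 5. intros K'. induction 1 as [|K' HK' IH].
      - lra.
      - rewrite !Rsum1_S. specialize (He (S K') K ltac:(lia)). lra. }
    rewrite Rabs_pos_eq.
    - specialize (HN K ltac:(lia)). lra.
    - rewrite <- (Rmult_0_l (Rsum1 (fun _ => 0%R) K)), <- Rsum1_mult_l.
      apply Rsum1_le. intros. rewrite Rmult_0_l. apply Cmod_ge_0. }
  assert (H0 : Clim (fun K => sum1 (fun k => sum1 (f k) K - s k) K) 0).
  { eapply Clim_squeeze; [|exact Hlim]. intros K.
    eapply Rle_trans; [|apply Cmod_sum1].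
    right. f_equal. ring. }
  replace l with (0 + l) by ring.
  eapply Clim_ext; [|exact (Clim_plus _ _ _ _ H0 Hs)].
  intros K. cbv beta. rewrite <- sum1_plus. apply sum1_ext. intros k _. ring.
Qed.

(** * Partial fractions *)

Lemma binom_n_n (n : nat) : Binomial.C n n = 1%R.
Proof.
  unfold Binomial.C. rewrite Nat.sub_diag. simpl. field. apply INR_fact_neq_0.
Qed.

Lemma binom_n_0 (n : nat) : Binomial.C n 0 = 1%R.
Proof.
  unfold Binomial.C. rewrite Nat.sub_0_r. simpl. field. apply INR_fact_neq_0.
Qed.

(** If [X + Y = X * Y], every mixed monomial can be rewritten as a polynomial in [X] plus a
    polynomial in [Y]. This is the [X] part of [X ^ (p + 1) * Y ^ (q + 1)]; shifting both exponents
    by one lets the inductions start at 0. *)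
Definition binom_poly (X : R) (p q : nat) : R :=
  Rsum1 (fun j => (Binomial.C (S p + q - j) q * X ^ j)%R) (S p).

Lemma binom_poly_0 (X : R) (q : nat) : binom_poly X 0 q = X.
Proof.
  unfold binom_poly. rewrite Rsum1_S, Rsum1_0.
  replace (1 + q - 1)%nat with q by lia. rewrite binom_n_n. ring.
Qed.

Lemma binom_poly_S_0 (X : R) (p : nat) :
  binom_poly X (S p) 0 = (binom_poly X p 0 + X ^ S (S p))%R.
Proof.
  unfold binom_poly. rewrite (Rsum1_S _ (S p)), binom_n_0, Rmult_1_l.
  f_equal. apply Rsum1_ext. intros k _. now rewrite !binom_n_0.
Qed.

Lemma binom_poly_S_S (X : R) (p q : nat) :
  binom_poly X (S p) (S q) = (binom_poly X p (S q) + binom_poly X (S p) q)%R.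
Proof.
  unfold binom_poly. rewrite (Rsum1_S _ (S p)), (Rsum1_S _ (S p)).
  replace (S (S p) + S q - S (S p))%nat with (S q) by lia.
  replace (S (S p) + q - S (S p))%nat with q by lia.
  rewrite !binom_n_n, <- Rplus_assoc, <- Rsum1_plus. f_equal.
  apply Rsum1_ext. intros k Hk.
  replace (S (S p) + S q - k)%nat with (S (S (S p) + q - k)) by lia.
  replace (S p + S q - k)%nat with (S (S p) + q - k)%nat by lia.
  rewrite <- pascal by lia. ring.
Qed.

(** Replacing one factor [X * Y] by [X + Y] lowers one exponent at a time, and by Pascal's rule
    [binom_poly] obeys the same recursion. *)
Lemma binom_poly_split (X Y : R) (p q : nat) :
  (X + Y = X * Y)%R ->
  (X ^ S p * Y ^ S q)%R = (binom_poly X p q + binom_poly Y q p)%R.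
Proof.
  intros HXY.
  assert (E : forall p q, (X ^ S (S p) * Y ^ S (S q))%R =
     (X ^ S p * Y ^ S (S q) + X ^ S (S p) * Y ^ S q)%R).
  { intros p' q'.
    replace (X ^ S (S p') * Y ^ S (S q'))%R
      with (X ^ S p' * Y ^ S q' * (X * Y))%R by (simpl; ring).
    rewrite <- HXY. simpl; ring. }
  revert q. induction p as [|p IHp].
  - induction q as [|q IHq].
    + rewrite !binom_poly_0, HXY. ring.
    + rewrite binom_poly_0, binom_poly_S_0 in *.
      replace (X ^ 1 * Y ^ S (S q))%R with (X * Y * Y ^ S q)%R by (simpl; ring).
      rewrite <- HXY, Rmult_plus_distr_r.
      rewrite pow_1 in IHq. rewrite IHq. simpl; ring.
  - induction q as [|q IHq].
    + specialize (IHp 0%nat). rewrite binom_poly_0, binom_poly_S_0 in *.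
      replace (X ^ S (S p) * Y ^ 1)%R with (X ^ S p * (X * Y))%R by (simpl; ring).
      rewrite <- HXY, Rmult_plus_distr_l.
      rewrite pow_1 in IHp. rewrite IHp. simpl; ring.
    + rewrite E, IHp, IHq, (binom_poly_S_S X), (binom_poly_S_S Y). ring.
Qed.

(** At [X = 1] the recursion of [binom_poly] is again Pascal's rule. The value there is the sum of
    the coefficients, from which [hockey_stick] is read off. *)
Lemma binom_poly_at_1 (p q : nat) :
  binom_poly 1 p q = Binomial.C (S (p + q)) (S q).
Proof.
  revert q. induction p as [|p IHp]; intros q.
  - now rewrite binom_poly_0, binom_n_n.
  - induction q as [|q IHq].
    + rewrite binom_poly_S_0, IHp, pow1.
      replace (S (S p + 0)) with (S (S (p + 0))) by lia.
      rewrite <- (pascal (S (p + 0)) 0) by lia. rewrite binom_n_0. ring.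
    + rewrite binom_poly_S_S, IHp, IHq.
      replace (S (S p + S q)) with (S (S (p + S q))) by lia.
      rewrite <- (pascal (S (p + S q)) (S q)) by lia.
      replace (S (S p + q)) with (S (p + S q)) by lia. ring.
Qed.

Lemma hockey_stick (p q : nat) : (1 <= p)%nat -> (1 <= q)%nat ->
  Rsum1 (fun j => Binomial.C (p + q - j - 1) (q - 1)) p =
  Binomial.C (p + q - 1) q.
Proof.
  intros Hp Hq. destruct p as [|p]; [lia|]. destruct q as [|q]; [lia|].
  replace (S p + S q - 1)%nat with (S (p + q)) by lia.
  rewrite <- binom_poly_at_1. apply Rsum1_ext. intros j Hj.
  rewrite pow1, Rmult_1_r. f_equal; lia.
Qed.

Lemma partial_fractions (u v s : R) (p q : nat) :
  (1 <= p)%nat -> (1 <= q)%nat ->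
  u <> 0%R -> v <> 0%R -> s <> 0%R -> (u + v = s)%R ->
  (/ (u ^ p * v ^ q))%R =
  (Rsum1 (fun j => Binomial.C (p + q - j - 1) (q - 1) / (s ^ (p + q - j) * u ^ j))%R p
   + Rsum1 (fun i => Binomial.C (p + q - i - 1) (p - 1) / (s ^ (p + q - i) * v ^ i))%R q)%R.
Proof.
  intros Hp Hq Hu Hv Hs Huv.
  destruct p as [|p]; [lia|]. destruct q as [|q]; [lia|].
  (* For [X = s / u] and [Y = s / v], the relation [X + Y = X * Y] is just [u + v = s]. Dividing by
     [s ^ (p + q)] restores the homogeneous form. *)
  assert (H := binom_poly_split (s / u) (s / v) p q
                 ltac:(rewrite <- Huv in *; field; tauto)).
  unfold binom_poly in H.
  assert (E : forall x n j r, x <> 0%R -> (j <= n)%nat ->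
     (r / (s ^ (n - j) * x ^ j))%R = (/ s ^ n * (r * (s / x) ^ j))%R).
  { intros x n j r Hx Hj. unfold Rdiv. rewrite Rpow_mult_distr, pow_inv.
    replace (s ^ n)%R with (s ^ (n - j) * s ^ j)%R
      by (rewrite <- pow_add; f_equal; lia).
    field. repeat split; apply pow_nonzero; trivial. }
  transitivity (/ s ^ (S p + S q) * ((s / u) ^ S p * (s / v) ^ S q))%R.
  - unfold Rdiv. rewrite !Rpow_mult_distr, !pow_inv, pow_add.
    field. repeat split; apply pow_nonzero; trivial.
  - rewrite H, Rmult_plus_distr_l, <- !Rsum1_mult_l. f_equal.
    + apply Rsum1_ext. intros j Hj. rewrite E by (trivial; lia).
      do 3 f_equal; lia.
    + apply Rsum1_ext. intros j Hj. rewrite E by (trivial; lia).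
      do 3 f_equal; lia.
Qed.

Lemma sum_even_terms (c : nat -> R) (n : nat) :
  Rsum1 (fun i => (1 + (-1) ^ i) * c i)%R n =
  (2 * Rsum1 (fun i => c (2 * i)%nat) (n / 2))%R.
Proof.
  assert (Heven : forall k, Rsum1 (fun i => (1 + (-1) ^ i) * c i)%R (2 * k) =
     (2 * Rsum1 (fun i => c (2 * i)%nat) k)%R).
  { induction k as [|k IH].
    - rewrite !Rsum1_0. ring.
    - replace (2 * S k)%nat with (S (S (2 * k))) by lia.
      rewrite !Rsum1_S, IH.
      replace (S (S (2 * k))) with (2 * S k)%nat at 1 by lia.
      rewrite pow_1_odd, pow_1_even.
      replace (2 * S k)%nat with (S (S (2 * k))) by lia. ring. }
  destruct (Nat.Even_or_Odd n) as [[k ->] | [k ->]].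
  - rewrite Heven, (Nat.mul_comm 2 k), Nat.div_mul by lia. reflexivity.
  - rewrite Nat.add_1_r, Rsum1_S, Heven, pow_1_odd.
    replace (S (2 * k) / 2)%nat with k; [ring|].
    apply Nat.div_unique with 1%nat; lia.
Qed.

(* The coefficients of [b x] in [Mbar b n p] and [Msum b n p]; for [p = 1] the
   terms [/ INR x] come from the differences in [Fterm] and [Fbarterm]. *)
Definition kernel_plus (p n x : nat) : R :=
  (/ (INR n + INR x) ^ p - (if Nat.eqb p 1 then / INR x else 0))%R.

Definition kernel_minus (p n x : nat) : R :=
  ((if Nat.eqb n x then 0 else / (INR n - INR x) ^ p)
   + (if Nat.eqb p 1 then / INR x else 0))%R.

Lemma INR_neq_0 (n : nat) : (1 <= n)%nat -> INR n <> 0%R.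
Proof. intros H. apply not_0_INR. lia. Qed.

Lemma pow_m1_sqr (n : nat) : ((-1) ^ n * (-1) ^ n = 1)%R.
Proof. rewrite <- Rpow_mult_distr. replace (-1 * -1)%R with 1%R by ring. apply pow1. Qed.

(** On the right the [1 / x] corrections of the two kernels cancel inside each sum. On the left, for
    [p = 1], they add up to [(1 + (-1) ^ q) / (k ^ q * m)], which accounts for the term that the
    convention [D(1) = 0] removes. *)
Lemma kernel_identity (p q k m : nat) :
  (1 <= p)%nat -> (1 <= q)%nat -> (1 <= k)%nat -> (1 <= m)%nat ->
  ((-1) ^ (p + q) * (/ INR k ^ q * kernel_plus p k m)
   + / INR k ^ q * kernel_minus p k m)%R =
  ((-1) ^ p * Rsum1 (fun j => Binomial.C (p + q - j - 1) (q - 1) *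
      (/ INR m ^ (p + q - j) * (kernel_plus j m k + kernel_minus j m k)))%R p
   + (-1) ^ p * 2 * Rsum1 (fun i => Binomial.C (p + q - 2 * i - 1) (p - 1) *
      (if Nat.eqb (p + q - 2 * i) 1 then 0
       else / INR k ^ (2 * i) * / INR m ^ (p + q - 2 * i)))%R (q / 2)
   - (-1) ^ p * Binomial.C (p + q - 1) p *
      (if Nat.eqb k m then / INR k ^ (p + q) else 0))%R.
Proof.
  intros Hp Hq Hk Hm.
  assert (Hk0 := INR_neq_0 k Hk). assert (Hm0 := INR_neq_0 m Hm).
  assert (Hkp : (0 < INR k)%R) by (apply lt_0_INR; lia).
  assert (Hmp : (0 < INR m)%R) by (apply lt_0_INR; lia).
  set (x := INR k) in *. set (y := INR m) in *.
  set (B := fun j => Binomial.C (p + q - j - 1) (q - 1)).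
  set (c := fun i => (Binomial.C (p + q - i - 1) (p - 1) / (y ^ (p + q - i) * x ^ i))%R).
  (* Since [i <= q], only the term [i = q] with [p = 1] is dropped, the one where [y] has exponent
     1. *)
  set (c' := fun i => if Nat.eqb (p + q - i) 1 then 0%R else c i).
  assert (Hplus : (/ ((y + x) ^ p * (- x) ^ q))%R =
     (Rsum1 (fun j => B j * (/ y ^ (p + q - j) * / (y + x) ^ j))%R p
      + Rsum1 (fun i => (-1) ^ i * c i)%R q)%R).
  { rewrite (partial_fractions (y + x) (- x) y p q) by (trivial; lra).
    f_equal; apply Rsum1_ext; intros i Hi.
    - unfold B, Rdiv. now rewrite Rinv_mult.
    - unfold c, Rdiv. replace (- x)%R with ((-1) * x)%R by ring.
      rewrite Rpow_mult_distr, !Rinv_mult, <- (pow_inv (-1)).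
      replace (/ -1)%R with (-1)%R by lra. ring. }
  (* For [k = m] the singular terms count as 0, and every [c i] is a binomial coefficient times
     [/ x ^ (p + q)]. Their hockey-stick sum has to be subtracted, which creates the diagonal
     term. *)
  assert (Hminus : (if Nat.eqb k m then 0 else / ((y - x) ^ p * x ^ q))%R =
     (Rsum1 (fun j => B j * (/ y ^ (p + q - j) *
                             (if Nat.eqb m k then 0 else / (y - x) ^ j)))%R p
      + Rsum1 c q
      - Binomial.C (p + q - 1) p * (if Nat.eqb k m then / x ^ (p + q) else 0))%R).
  { rewrite (Nat.eqb_sym m k). destruct (Nat.eqb_spec k m) as [E|E].
    - assert (Exy : y = x) by (unfold x, y; now rewrite E).
      rewrite (Rsum1_ext _ (fun j => 0 * B j)%R) by (intros; ring).
      rewrite Rsum1_mult_l.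
      rewrite (Rsum1_ext c (fun i => / x ^ (p + q) *
                  Binomial.C (q + p - i - 1) (p - 1))%R).
      + rewrite Rsum1_mult_l, hockey_stick, (Nat.add_comm q p) by trivial. ring.
      + intros i Hi. unfold c. rewrite Exy, <- pow_add.
        replace (p + q - i + i)%nat with (p + q)%nat by lia.
        rewrite (Nat.add_comm q p). unfold Rdiv. ring.
    - assert (y <> x) by (unfold x, y; intros Exy; apply INR_eq in Exy; congruence).
      rewrite (partial_fractions (y - x) x y p q) by (trivial; lra).
      rewrite Rmult_0_r, Rminus_0_r.
      f_equal. apply Rsum1_ext; intros i Hi. unfold B, Rdiv. now rewrite Rinv_mult. }
  (* Adding the expansions at [x] and [- x] kills odd [i] and doubles even [i]. The dropped term
     [i = q] for [p = 1] is kept apart, to meet the kernel corrections. *)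
  assert (Hc : (Rsum1 (fun i => (-1) ^ i * c i)%R q + Rsum1 c q =
     2 * Rsum1 (fun i => c' (2 * i)%nat) (q / 2)
     + (if Nat.eqb p 1 then (1 + (-1) ^ q) * (/ y * / x ^ q) else 0))%R).
  { rewrite <- sum_even_terms, <- Rsum1_plus.
    destruct q as [|q]; [lia|]. rewrite !Rsum1_S.
    rewrite (Rsum1_ext (fun i => (-1) ^ i * c i + c i)%R
                       (fun i => (1 + (-1) ^ i) * c' i)%R).
    - unfold c'. replace (p + S q - S q)%nat with p by lia.
      destruct (Nat.eqb_spec p 1) as [E|E]; [|ring].
      unfold c. replace (p + S q - S q)%nat with 1%nat by lia.
      replace (1 - 1)%nat with 0%nat by lia. rewrite E, binom_n_0, pow_1.
      unfold Rdiv. rewrite Rinv_mult. ring.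
    - intros i Hi. unfold c'. destruct (Nat.eqb_spec (p + S q - i) 1); [lia|ring]. }
  assert (Hk1 : (/ x ^ q * kernel_minus p k m)%R =
     ((-1) ^ p * (if Nat.eqb k m then 0 else / ((y - x) ^ p * x ^ q))
      + / x ^ q * (if Nat.eqb p 1 then / y else 0))%R).
  { unfold kernel_minus. fold x y. rewrite Rmult_plus_distr_l. f_equal.
    destruct (Nat.eqb_spec k m); [ring|].
    replace (x - y)%R with ((-1) * (y - x))%R by ring.
    rewrite Rpow_mult_distr, !Rinv_mult, <- (pow_inv (-1)).
    replace (/ -1)%R with (-1)%R by lra. ring. }
  assert (Hk2 : ((-1) ^ (p + q) * (/ x ^ q * kernel_plus p k m))%R =
     ((-1) ^ p * (/ ((y + x) ^ p * (- x) ^ q))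
      - (-1) ^ (p + q) * (/ x ^ q * (if Nat.eqb p 1 then / y else 0)))%R).
  { unfold kernel_plus. fold x y.
    replace (- x)%R with ((-1) * x)%R by ring.
    rewrite Rpow_mult_distr, !Rinv_mult, <- (pow_inv (-1)).
    replace (/ -1)%R with (-1)%R by lra.
    rewrite (Rplus_comm y x), pow_add. ring. }
  rewrite Hk1, Hk2, Hplus, Hminus.
  rewrite (Rsum1_ext (fun j => Binomial.C (p + q - j - 1) (q - 1) *
      (/ y ^ (p + q - j) * (kernel_plus j m k + kernel_minus j m k)))%R
    (fun j => B j * (/ y ^ (p + q - j) * / (y + x) ^ j)
     + B j * (/ y ^ (p + q - j) * (if Nat.eqb m k then 0 else / (y - x) ^ j)))%R).
  2:{ intros j Hj. unfold B, kernel_plus, kernel_minus. fold x y.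
      destruct (Nat.eqb j 1); ring. }
  rewrite Rsum1_plus.
  rewrite (Rsum1_ext (fun i => Binomial.C (p + q - 2 * i - 1) (p - 1) *
      (if Nat.eqb (p + q - 2 * i) 1 then 0
       else / x ^ (2 * i) * / y ^ (p + q - 2 * i)))%R
    (fun i => c' (2 * i)%nat)).
  2:{ intros i Hi. unfold c', c. destruct (Nat.eqb (p + q - 2 * i) 1); [ring|].
      unfold Rdiv. rewrite Rinv_mult. ring. }
  set (U := Rsum1 (fun j => B j * (/ y ^ (p + q - j) * / (y + x) ^ j))%R p).
  set (V := Rsum1 (fun j => B j * (/ y ^ (p + q - j) * _))%R p).
  set (W := Rsum1 (fun i => c' (2 * i)%nat) (q / 2)) in *.
  set (b := Binomial.C (p + q - 1) p).
  set (D := if Nat.eqb k m then (/ x ^ (p + q))%R else 0%R).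
  (* The two sums joined in [Hc] sit in different summands of the goal. Adding the negative of their
     combination to both sides makes it appear as a block, so that [Hc] can be applied on one side
     only. *)
  apply Rplus_eq_reg_r with (- ((-1) ^ p * (Rsum1 (fun i => (-1) ^ i * c i) q + Rsum1 c q)))%R.
  rewrite Hc at 2.
  rewrite pow_add. destruct (Nat.eqb_spec p 1) as [E|E].
  - rewrite E. simpl ((-1) ^ 1)%R. ring.
  - ring.
Qed.

(** * Kernel estimates *)

Lemma Rpower_pos (x e : R) : (0 < Rpower x e)%R.
Proof. apply exp_pos. Qed.

Lemma Rpower_le_neg (x y e : R) :
  (0 < x <= y)%R -> (e <= 0)%R -> (Rpower y e <= Rpower x e)%R.
Proof.
  intros H He. replace e with (- - e)%R by ring. rewrite !(Rpower_Ropp _ (- e)).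
  apply Rinv_le_contravar; [apply Rpower_pos | apply Rle_Rpower_l; lra].
Qed.

Lemma Rpower_ge_1 (x e : R) : (1 <= x)%R -> (0 <= e)%R -> (1 <= Rpower x e)%R.
Proof.
  intros Hx He. rewrite <- (Rpower_O x) by lra. now apply Rle_Rpower.
Qed.

Lemma Rpower_m1 (x e : R) : (0 < x)%R -> (Rpower x (e - 1) = Rpower x e / x)%R.
Proof.
  intros Hx. unfold Rminus. rewrite Rpower_plus, Rpower_Ropp, Rpower_1 by trivial.
  reflexivity.
Qed.

Lemma INR_ge_1 (n : nat) : (1 <= n)%nat -> (1 <= INR n)%R.
Proof. intros H. now apply (le_INR 1). Qed.

(** The value 0 at [r = 0] makes the diagonal [x = n] contribute nothing to sums of
    [weight d (dist n x)]. *)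
Definition weight (d : R) (r : nat) : R :=
  if Nat.eqb r 0 then 0%R else Rpower (INR r) (- 1 - d).

Lemma weight_ge_0 (d : R) (r : nat) : (0 <= weight d r)%R.
Proof.
  unfold weight. destruct (Nat.eqb r 0); [lra|]. apply Rlt_le, Rpower_pos.
Qed.

Lemma weight_eq (d : R) (r : nat) :
  (1 <= r)%nat -> weight d r = (Rpower (INR r) (- d) / INR r)%R.
Proof.
  intros Hr. unfold weight. destruct (Nat.eqb_spec r 0); [lia|].
  replace (- 1 - d)%R with (- d - 1)%R by ring.
  apply Rpower_m1. apply lt_0_INR. lia.
Qed.

(** A mean value inequality for [x ^ (- d)], obtained from [1 + t <= exp t] used once for the
    logarithm and once for the power. Summing it bounds the sums of [weight d] by [1 + 1 / d]. *)
Lemma Rpower_telescope (x d : R) : (1 <= x)%R -> (0 < d)%R ->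
  (d * (Rpower (x + 1) (- d) / (x + 1)) <= Rpower x (- d) - Rpower (x + 1) (- d))%R.
Proof.
  intros Hx Hd.
  assert (Hln : (ln x <= ln (x + 1) - / (x + 1))%R).
  { replace x with ((x + 1) * (x / (x + 1)))%R at 1 by (field; lra).
    rewrite ln_mult; [|lra|apply Rdiv_lt_0_compat; lra].
    apply Rplus_le_compat_l.
    assert (H := exp_ineq1_le (- / (x + 1))).
    rewrite <- (ln_exp (- / (x + 1))). apply ln_le.
    - apply Rdiv_lt_0_compat; lra.
    - replace (x / (x + 1))%R with (1 + - / (x + 1))%R by (field; lra). exact H. }
  assert (H : (Rpower (x + 1) (- d) * (1 + d * / (x + 1)) <= Rpower x (- d))%R).
  { unfold Rpower.
    apply Rle_trans with (exp (- d * ln (x + 1)) * exp (d * / (x + 1)))%R.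
    - apply Rmult_le_compat_l; [apply Rlt_le, exp_pos | apply exp_ineq1_le].
    - rewrite <- exp_plus. apply Rnot_lt_le. intros h.
      apply exp_lt_inv in h. revert h. apply Rle_not_lt.
      replace (- d * ln (x + 1) + d * / (x + 1))%R
        with (- (d * (ln (x + 1) - / (x + 1))))%R by ring.
      assert (d * ln x <= d * (ln (x + 1) - / (x + 1)))%R
        by (apply Rmult_le_compat_l; lra). lra. }
  unfold Rdiv. lra.
Qed.

Lemma weight_bounded_sums (d : R) : (0 < d)%R -> bounded_sums (weight d).
Proof.
  intros Hd. exists (1 + / d)%R.
  assert (H : forall K, (1 <= K)%nat ->
            (d * Rsum1 (weight d) K <= d + 1 - Rpower (INR K) (- d))%R).
  { induction 1 as [|K HK IH].
    - rewrite Rsum1_S, Rsum1_0, weight_eq by lia. simpl INR.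
      rewrite Rpower_Ropp. unfold Rpower. rewrite ln_1, Rmult_0_r, exp_0. lra.
    - rewrite Rsum1_S, weight_eq, S_INR by lia.
      assert (H := Rpower_telescope (INR K) d (INR_ge_1 K HK) Hd). lra. }
  intros [|K].
  - rewrite Rsum1_0. assert (0 < / d)%R by now apply Rinv_0_lt_compat. lra.
  - apply Rmult_le_reg_l with d; trivial. specialize (H (S K) ltac:(lia)).
    assert (Hp := Rpower_pos (INR (S K)) (- d)).
    replace (d * (1 + / d))%R with (d + 1)%R by (field; lra). lra.
Qed.

Definition dist (n x : nat) : nat := (n - x) + (x - n).

Lemma INR_dist (n x : nat) : INR (dist n x) = Rabs (INR n - INR x).
Proof.
  unfold dist. destruct (Nat.le_ge_cases n x) as [H|H].
  - replace (n - x + (x - n))%nat with (x - n)%nat by lia.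
    rewrite minus_INR by trivial. apply le_INR in H.
    rewrite Rabs_left1 by lra. ring.
  - replace (n - x + (x - n))%nat with (n - x)%nat by lia.
    rewrite minus_INR by trivial. apply le_INR in H.
    rewrite Rabs_pos_eq by lra. ring.
Qed.

(** Every positive distance from [n] is attained at most twice, once on each side, whence the factor
    2 uniformly in [n]. *)
Lemma sum_weight_dist (d M : R) (n K : nat) :
  (1 <= n)%nat -> (forall K, (Rsum1 (weight d) K <= M)%R) ->
  (Rsum1 (fun x => weight d (dist n x)) K <= 2 * M)%R.
Proof.
  intros Hn HM.
  (* The left side is a reversed piece of the sum up to [n - 1]. Truncated subtraction and
     [weight d 0 = 0] keep the equation true for [K >= n]. *)
  assert (Hl : (Rsum1 (fun x => weight d (n - x)) K + Rsum1 (weight d) (n - 1 - K)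
                = Rsum1 (weight d) (n - 1))%R).
  { induction K as [|K IH].
    - rewrite Rsum1_0, Nat.sub_0_r. ring.
    - rewrite <- IH, Rsum1_S. destruct (Nat.le_gt_cases n (S K)) as [H|H].
      + replace (n - S K)%nat with 0%nat by lia.
        replace (n - 1 - S K)%nat with (n - 1 - K)%nat by lia.
        unfold weight at 2. simpl. ring.
      + replace (n - 1 - K)%nat with (S (n - 1 - S K)) by lia.
        rewrite (Rsum1_S (weight d)).
        replace (S (n - 1 - S K)) with (n - S K)%nat by lia. ring. }
  assert (Hr : Rsum1 (fun x => weight d (x - n)) K = Rsum1 (weight d) (K - n)).
  { clear Hl. induction K as [|K IH].
    - now rewrite !Rsum1_0.
    - rewrite Rsum1_S, IH. destruct (Nat.le_gt_cases (S K) n) as [H|H].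
      + replace (S K - n)%nat with 0%nat by lia.
        replace (K - n)%nat with 0%nat by lia. unfold weight at 2. simpl. ring.
      + replace (S K - n)%nat with (S (K - n)) by lia. now rewrite Rsum1_S. }
  rewrite (Rsum1_ext _ (fun x => weight d (n - x) + weight d (x - n))%R).
  - rewrite Rsum1_plus, Hr.
    assert (0 <= Rsum1 (weight d) (n - 1 - K))%R.
    { rewrite <- (Rmult_0_l (Rsum1 (weight d) (n - 1 - K))), <- Rsum1_mult_l.
      apply Rsum1_le. intros. rewrite Rmult_0_l. apply weight_ge_0. }
    assert (H1 := HM (n - 1)%nat). assert (H2 := HM (K - n)%nat). lra.
  - intros x _. unfold dist, weight.
    destruct (Nat.eqb_spec (n - x) 0), (Nat.eqb_spec (x - n) 0),
      (Nat.eqb_spec (n - x + (x - n)) 0); try lia; try ring.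
    + replace (n - x)%nat with 0%nat by lia. simpl. ring.
    + replace (x - n)%nat with 0%nat by lia. rewrite Nat.add_0_r. ring.
Qed.

Lemma pow_ge_1 (x : R) (n : nat) : (1 <= x)%R -> (1 <= x ^ n)%R.
Proof. intros H. now apply pow_R1_Rle. Qed.

(** For [p = 1] the bound is an equality. For [p >= 2] it follows from [X <= N * (N + X)]. *)
Lemma Rabs_kernel_plus (p n x : nat) :
  (1 <= p)%nat -> (1 <= n)%nat -> (1 <= x)%nat ->
  (Rabs (kernel_plus p n x) <= INR n / (INR x * (INR n + INR x)))%R.
Proof.
  intros Hp Hn Hx. unfold kernel_plus.
  apply INR_ge_1 in Hn, Hx. set (N := INR n) in *. set (X := INR x) in *.
  destruct (Nat.eqb_spec p 1) as [->|E].
  - right. rewrite pow_1.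
    replace (/ (N + X) - / X)%R with (- (N / (X * (N + X))))%R by (field; lra).
    rewrite Rabs_Ropp. apply Rabs_pos_eq.
    apply Rlt_le, Rdiv_lt_0_compat; [lra|]. apply Rmult_lt_0_compat; lra.
  - rewrite Rminus_0_r. destruct p as [|[|p]]; [lia|lia|].
    assert (H1 := pow_ge_1 (N + X) p ltac:(lra)).
    assert (H2 : (0 < (N + X) ^ S (S p))%R) by (apply pow_lt; lra).
    rewrite Rabs_pos_eq by (apply Rlt_le, Rinv_0_lt_compat; trivial).
    apply Rmult_le_reg_r with ((N + X) ^ S (S p))%R; trivial.
    rewrite Rinv_l by lra.
    replace (N / (X * (N + X)) * (N + X) ^ S (S p))%R
      with (/ X * (N * (N + X) * (N + X) ^ p))%R by (simpl; field; lra).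
    apply Rmult_le_reg_l with X; [lra|].
    replace (X * (/ X * (N * (N + X) * (N + X) ^ p)))%R
      with (N * (N + X) * (N + X) ^ p)%R by (field; lra).
    apply Rle_trans with ((1 * X) * 1)%R; [lra|].
    apply Rmult_le_compat; nra.
Qed.

(** The factor 2 serves [p >= 2], where [X <= N + r <= 2 * N * r] because [N] and [r] are at least
    1. *)
Lemma Rabs_kernel_minus (p n x : nat) :
  (1 <= p)%nat -> (1 <= n)%nat -> (1 <= x)%nat -> n <> x ->
  (Rabs (kernel_minus p n x) <= 2 * (INR n / (INR x * INR (dist n x))))%R.
Proof.
  intros Hp Hn Hx Hnx. unfold kernel_minus.
  assert (Hr : (1 <= dist n x)%nat) by (unfold dist; lia).
  apply INR_ge_1 in Hr. rewrite INR_dist in *.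
  apply INR_ge_1 in Hn, Hx.
  destruct (Nat.eqb_spec n x) as [|_]; [contradiction|].
  set (N := INR n) in *. set (X := INR x) in *.
  set (r := Rabs (N - X)) in *.
  assert (Hd : (N - X <> 0)%R).
  { intros H. unfold r in Hr. rewrite H, Rabs_R0 in Hr. lra. }
  destruct (Nat.eqb_spec p 1) as [->|E].
  - rewrite pow_1.
    replace (/ (N - X) + / X)%R with (N / (X * (N - X)))%R by (field; lra).
    unfold Rdiv. rewrite Rabs_mult, Rabs_inv, Rabs_mult.
    rewrite (Rabs_pos_eq N), (Rabs_pos_eq X) by lra.
    fold r. assert (0 <= N * / (X * r))%R; [|lra].
    apply Rlt_le, Rdiv_lt_0_compat; [lra|]. apply Rmult_lt_0_compat; lra.
  - rewrite Rplus_0_r, Rabs_inv, <- RPow_abs. fold r.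
    destruct p as [|[|p]]; [lia|lia|].
    assert (H1 := pow_ge_1 r p ltac:(lra)).
    assert (H2 : (0 < r ^ S (S p))%R) by (apply pow_lt; lra).
    assert (HX : (X <= N + r)%R).
    { assert (H := Rle_abs (- (N - X))). rewrite Rabs_Ropp in H. fold r in H. lra. }
    apply Rmult_le_reg_r with (r ^ S (S p))%R; trivial.
    rewrite Rinv_l by lra.
    replace (2 * (N / (X * r)) * r ^ S (S p))%R
      with (/ X * (2 * N * r * r ^ p))%R by (simpl; field; lra).
    apply Rmult_le_reg_l with X; [lra|].
    replace (X * (/ X * (2 * N * r * r ^ p)))%R
      with (2 * N * r * r ^ p)%R by (field; lra).
    apply Rle_trans with (2 * N * r * 1)%R; [nra|].
    apply Rmult_le_compat_l; nra.
Qed.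

(* Splitting [Rpower X b] at [X = N] trades a growing factor for a power of
   [N], which leaves a summable function of [X] or of the distance [r]. *)
Lemma Rpower_far_bound (N X b d : R) :
  (1 <= N)%R -> (1 <= X)%R -> (0 < b)%R -> (0 < d)%R -> (b + d < 1)%R ->
  (Rpower X b * (N / (X * (N + X))) <= Rpower N (b + d) * (Rpower X (- d) / X))%R.
Proof.
  intros HN HX Hb Hd Hbd.
  assert (H : (Rpower X (b + d) * N <= Rpower N (b + d) * (N + X))%R).
  { assert (P1 := Rpower_pos N (b + d)). assert (P2 := Rpower_pos X (b + d)).
    destruct (Rle_lt_dec X N) as [h|h].
    - assert (Rpower X (b + d) <= Rpower N (b + d))%R by (apply Rle_Rpower_l; lra).
      nra.
    - assert (E : (Rpower X (b + d - 1) <= Rpower N (b + d - 1))%R)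
        by (apply Rpower_le_neg; lra).
      rewrite !Rpower_m1 in E by lra.
      apply Rmult_le_compat_r with (r := (X * N)%R) in E; [|nra].
      replace (Rpower X (b + d) / X * (X * N))%R
        with (Rpower X (b + d) * N)%R in E by (field; lra).
      replace (Rpower N (b + d) / N * (X * N))%R
        with (Rpower N (b + d) * X)%R in E by (field; lra).
      nra. }
  replace (Rpower X b) with (Rpower X (b + d) * Rpower X (- d))%R
    by (rewrite <- Rpower_plus; f_equal; ring).
  replace (Rpower X (b + d) * Rpower X (- d) * (N / (X * (N + X))))%R
    with ((Rpower X (b + d) * N) * (Rpower X (- d) / (X * (N + X))))%R
    by (field; lra).
  replace (Rpower N (b + d) * (Rpower X (- d) / X))%R
    with ((Rpower N (b + d) * (N + X)) * (Rpower X (- d) / (X * (N + X))))%R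
    by (field; lra).
  apply Rmult_le_compat_r; trivial.
  apply Rlt_le, Rdiv_lt_0_compat; [apply Rpower_pos | nra].
Qed.

Lemma Rpower_near_bound (N X b d : R) :
  (1 <= N)%R -> (1 <= X)%R -> (1 <= Rabs (N - X))%R ->
  (0 < b)%R -> (0 < d)%R -> (b + d < 1)%R ->
  (Rpower X b * (N / (X * Rabs (N - X))) <=
   Rpower N (b + d) *
     (Rpower X (- d) / X + Rpower (Rabs (N - X)) (- d) / Rabs (N - X)))%R.
Proof.
  intros HN HX Hr Hb Hd Hbd.
  set (r := Rabs (N - X)) in *.
  assert (PX := Rpower_pos X (- d)). assert (Pr := Rpower_pos r (- d)).
  assert (PN := Rpower_pos N (b + d)).
  assert (IX : (0 < / X)%R) by (apply Rinv_0_lt_compat; lra).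
  assert (Ir : (0 < / r)%R) by (apply Rinv_0_lt_compat; lra).
  assert (EX : Rpower X b = (Rpower X (b + d) * Rpower X (- d))%R)
    by (rewrite <- Rpower_plus; f_equal; ring).
  destruct (Rle_lt_dec X N) as [h|h].
  (* Here [N = X + r], so [N / (X * r)] splits as [1 / X + 1 / r], and each piece only needs
     [X, r <= N]. *)
  - assert (Er : r = (N - X)%R) by (apply Rabs_pos_eq; lra).
    replace (N / (X * r))%R with (/ X + / r)%R by (rewrite Er; field; lra).
    unfold Rdiv. rewrite !Rmult_plus_distr_l, <- !Rmult_assoc.
    apply Rplus_le_compat; (apply Rmult_le_compat_r; [lra|]).
    + rewrite EX. apply Rmult_le_compat_r; [lra|]. apply Rle_Rpower_l; lra.
    + replace (Rpower X b) with (Rpower X b * Rpower r d * Rpower r (- d))%R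
        by (rewrite Rmult_assoc, <- Rpower_plus, Rplus_opp_r, Rpower_O; lra).
      apply Rmult_le_compat_r; [lra|]. rewrite Rpower_plus.
      apply Rmult_le_compat; try (apply Rlt_le, Rpower_pos);
        apply Rle_Rpower_l; lra.
  (* Beyond [N] the exponent [b + d - 1] is negative, so the power of [X] is replaced by one of [N];
     from [r <= X], the leftover [X ^ (- d)] is at most [r ^ (- d)]. *)
  - assert (Er : r = (X - N)%R)
      by (unfold r; rewrite Rabs_left1 by lra; ring).
    assert (E : (Rpower X (b + d - 1) <= Rpower N (b + d - 1))%R)
      by (apply Rpower_le_neg; lra).
    rewrite !Rpower_m1 in E by lra.
    assert (Hx : (Rpower X (- d) <= Rpower r (- d))%R)
      by (apply Rpower_le_neg; lra).
    apply Rle_trans with (Rpower N (b + d) * (Rpower r (- d) / r))%R.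
    + rewrite EX.
      replace (Rpower X (b + d) * Rpower X (- d) * (N / (X * r)))%R
        with ((Rpower X (b + d) / X * N) * (Rpower X (- d) * / r))%R by (field; lra).
      replace (Rpower N (b + d) * (Rpower r (- d) / r))%R
        with ((Rpower N (b + d) / N * N) * (Rpower r (- d) * / r))%R by (field; lra).
      assert (PX' := Rpower_pos X (b + d)).
      apply Rmult_le_compat.
      * apply Rmult_le_pos; [|lra]. apply Rlt_le, Rdiv_lt_0_compat; lra.
      * apply Rmult_le_pos; lra.
      * apply Rmult_le_compat_r; lra.
      * apply Rmult_le_compat_r; lra.
    + apply Rmult_le_compat_l; [lra|].
      assert (0 < Rpower X (- d) / X)%R by (apply Rdiv_lt_0_compat; lra). lra.
Qed.

(** All that the limit arguments use about a kernel: summing a sequence of size [x ^ b] against row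
    [n] costs at most a multiple of [n ^ e]. Bounding partial sums avoids presupposing
    convergence. *)
Definition tame_kernel (b e : R) (kappa : nat -> nat -> R) : Prop :=
  exists c : R, (0 <= c)%R /\ forall n K, (1 <= n)%nat ->
    (Rsum1 (fun x => Rpower (INR x) b * Rabs (kappa n x)) K
     <= c * Rpower (INR n) e)%R.

Lemma tame_kernel_of_weight (b d : R) (kappa : nat -> nat -> R) :
  (0 < d)%R ->
  (forall n x, (1 <= n)%nat -> (1 <= x)%nat ->
    (Rpower (INR x) b * Rabs (kappa n x) <=
     2 * (Rpower (INR n) (b + d) * (weight d x + weight d (dist n x))))%R) ->
  tame_kernel b (b + d) kappa.
Proof.
  intros Hd H. destruct (weight_bounded_sums d Hd) as [M HM].
  assert (HM0 := HM 0%nat). rewrite Rsum1_0 in HM0.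
  (* Twice [M + 2 * M]: the weights of [x] and of the distance to [n]. *)
  exists (6 * M)%R. split; [lra|]. intros n K Hn.
  apply Rle_trans with
    (Rsum1 (fun x => 2 * Rpower (INR n) (b + d) *
                       (weight d x + weight d (dist n x)))%R K).
  - apply Rsum1_le. intros x Hx. rewrite Rmult_assoc. apply H; lia.
  - rewrite Rsum1_mult_l, Rsum1_plus.
    assert (H1 := HM K). assert (H2 := sum_weight_dist d M n K Hn HM).
    assert (P := Rpower_pos (INR n) (b + d)). nra.
Qed.

Lemma tame_kernel_plus (p : nat) (b d : R) :
  (1 <= p)%nat -> (0 < b)%R -> (0 < d)%R -> (b + d < 1)%R ->
  tame_kernel b (b + d) (kernel_plus p).
Proof.
  intros Hp Hb Hd Hbd. apply tame_kernel_of_weight; trivial. intros n x Hn Hx.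
  assert (H := Rpower_far_bound (INR n) (INR x) b d (INR_ge_1 n Hn)
                 (INR_ge_1 x Hx) Hb Hd Hbd).
  rewrite <- weight_eq in H by trivial.
  assert (W := weight_ge_0 d (dist n x)). assert (W' := weight_ge_0 d x).
  assert (P := Rpower_pos (INR n) (b + d)).
  apply Rle_trans with (Rpower (INR n) (b + d) * weight d x)%R; [|nra].
  eapply Rle_trans; [|exact H].
  apply Rmult_le_compat_l; [apply Rlt_le, Rpower_pos|].
  now apply Rabs_kernel_plus.
Qed.

Lemma tame_kernel_minus (p : nat) (b d : R) :
  (1 <= p)%nat -> (0 < b)%R -> (0 < d)%R -> (b + d < 1)%R ->
  tame_kernel b (b + d) (kernel_minus p).
Proof.
  intros Hp Hb Hd Hbd. apply tame_kernel_of_weight; trivial. intros n x Hn Hx.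
  assert (P := Rpower_pos (INR n) (b + d)).
  (* On the diagonal the kernel is at most [/ n], and [weight d n] alone covers it, as
     [n ^ (b + d) * n ^ (- d) = n ^ b]. *)
  destruct (Nat.eq_dec n x) as [<-|Hnx].
  - unfold kernel_minus. rewrite Nat.eqb_refl, Rplus_0_l.
    assert (W := weight_ge_0 d (dist n n)). assert (W' := weight_ge_0 d n).
    apply Rle_trans with (Rpower (INR n) (b + d) * weight d n)%R; [|nra].
    rewrite weight_eq by trivial. unfold Rdiv.
    rewrite <- Rmult_assoc, <- Rpower_plus.
    replace (b + d + - d)%R with b by ring.
    apply Rmult_le_compat_l; [apply Rlt_le, Rpower_pos|].
    apply INR_ge_1 in Hn. assert (0 < / INR n)%R by (apply Rinv_0_lt_compat; lra).
    destruct (Nat.eqb p 1); rewrite Rabs_pos_eq; lra.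
  - assert (Hr : (1 <= dist n x)%nat) by (unfold dist; lia).
    assert (Hr' := INR_ge_1 _ Hr). rewrite INR_dist in Hr'.
    assert (H := Rpower_near_bound (INR n) (INR x) b d (INR_ge_1 n Hn)
                   (INR_ge_1 x Hx) Hr' Hb Hd Hbd).
    rewrite <- INR_dist, <- !weight_eq in H by trivial.
    eapply Rle_trans; [|apply Rmult_le_compat_l, H; lra].
    rewrite <- (Rmult_assoc 2), (Rmult_comm 2 (Rpower _ _)), Rmult_assoc.
    apply Rmult_le_compat_l; [apply Rlt_le, Rpower_pos|].
    now apply Rabs_kernel_minus.
Qed.

(** * Sequences of power growth summed against kernels *)

Definition power_bounded (u : nat -> C) (e : R) : Prop :=
  exists c : R, (0 <= c)%R /\
    forall n, (1 <= n)%nat -> (Cmod (u n) <= c * Rpower (INR n) e)%R.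

(** The little-o condition with constant 1 settles large [n]. The finitely many earlier values are
    absorbed into the constant, using [n ^ e >= 1], which needs [0 <= e]. *)
Lemma little_o_pow_power_bounded (a : Z -> C) (alpha e : R) :
  little_o_pow a alpha -> (alpha <= e)%R -> (0 <= e)%R ->
  power_bounded (fun n => a (Z.of_nat n)) e.
Proof.
  intros [Ha _] Hae He. destruct (Ha (mkposreal 1 Rlt_0_1)) as [N HN].
  set (c := Rsum1 (fun k => Cmod (a (Z.of_nat k))) N).
  assert (Hc0 : forall n, (0 <= Rsum1 (fun k => Cmod (a (Z.of_nat k))) n)%R).
  { intros n. eapply Rle_trans; [|apply Cmod_sum1]. apply Cmod_ge_0. }
  exists (1 + c)%R. split; [specialize (Hc0 N); fold c in Hc0; lra|].
  intros n Hn. assert (Hn1 := INR_ge_1 n Hn).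
  assert (P := Rpower_ge_1 (INR n) e Hn1 He). specialize (Hc0 N). fold c in Hc0.
  destruct (Nat.le_gt_cases N n) as [h|h].
  - specialize (HN n h). simpl in HN. rewrite Rmult_1_l in HN.
    change (Cmod (a (Z.of_nat n)) <= Rabs (Rpower (INR n) alpha))%R in HN.
    rewrite Rabs_pos_eq in HN by apply Rlt_le, Rpower_pos.
    assert (Rpower (INR n) alpha <= Rpower (INR n) e)%R by (apply Rle_Rpower; lra).
    nra.
  - assert (Cmod (a (Z.of_nat n)) <= c)%R; [|nra].
    unfold c. clear - h Hn. induction h as [|N h IH]; rewrite Rsum1_S.
    + destruct n as [|n]; [lia|]. rewrite Rsum1_S.
      assert (0 <= Rsum1 (fun k => Cmod (a (Z.of_nat k))) n)%R.
      { eapply Rle_trans; [|apply Cmod_sum1]. apply Cmod_ge_0. }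
      assert (H1 := Cmod_ge_0 (a (Z.of_nat (S (S n))))). lra.
    + assert (H1 := Cmod_ge_0 (a (Z.of_nat (S N)))). lra.
Qed.

Definition kernel_sum (v : nat -> C) (kappa : nat -> nat -> R) (n : nat) : C :=
  Cseries1 (fun x => v x * RtoC (kappa n x)).

Lemma kernel_sum_row_bound (v : nat -> C) (b e : R) (kappa : nat -> nat -> R) :
  power_bounded v b -> tame_kernel b e kappa ->
  exists c, (0 <= c)%R /\ forall n K, (1 <= n)%nat ->
    (Rsum1 (fun x => Cmod (v x * RtoC (kappa n x))) K <= c * Rpower (INR n) e)%R.
Proof.
  intros [cv [Hcv Hv]] [c [Hc Hk]]. exists (cv * c)%R.
  split; [now apply Rmult_le_pos|]. intros n K Hn.
  apply Rle_trans with
    (Rsum1 (fun x => cv * (Rpower (INR x) b * Rabs (kappa n x)))%R K).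
  - apply Rsum1_le. intros x Hx. rewrite Cmod_mult, Cmod_R, <- Rmult_assoc.
    apply Rmult_le_compat_r; [apply Rabs_pos | apply Hv; lia].
  - rewrite Rsum1_mult_l, Rmult_assoc. apply Rmult_le_compat_l; trivial.
    now apply Hk.
Qed.

Lemma has_kernel_sum (v : nat -> C) (b e : R) (kappa : nat -> nat -> R) (n : nat) :
  power_bounded v b -> tame_kernel b e kappa -> (1 <= n)%nat ->
  has_sum (fun x => v x * RtoC (kappa n x)) (kernel_sum v kappa n).
Proof.
  intros Hv Hk Hn.
  destruct (kernel_sum_row_bound v b e kappa Hv Hk) as [c [_ Hc]].
  destruct (has_sum_dominated (fun x => v x * RtoC (kappa n x))
              (fun x => Cmod (v x * RtoC (kappa n x)))) as [l Hl].
  - intros. apply Rle_refl.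
  - exists (c * Rpower (INR n) e)%R. intros K. now apply Hc.
  - unfold kernel_sum. now rewrite (has_sum_Cseries1 _ _ Hl).
Qed.

(** Row [n] has absolute sum at most a multiple of [n ^ (a + e - s)], hence of [weight d n]. This
    gives both the convergence of the outer series and the domination required by
    [square_sums_limit]. *)
Lemma kernel_double_series (u v : nat -> C) (a b e d : R) (s : nat)
    (kappa : nat -> nat -> R) :
  power_bounded u a -> power_bounded v b -> tame_kernel b e kappa ->
  (0 < d)%R -> (a + e - INR s <= - 1 - d)%R ->
  exists l,
    has_sum (fun n => u n * RtoC (/ INR n ^ s) * kernel_sum v kappa n) l /\
    Clim (fun K => sum1 (fun n => sum1 (fun x =>
            u n * v x * RtoC (/ INR n ^ s * kappa n x)) K) K) l.
Proof.
  intros [cu [Hcu Hu]] Hv Hk Hd Has.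
  destruct (kernel_sum_row_bound v b e kappa Hv Hk) as [c [Hc Hrow]].
  set (w := fun n => (cu * c * weight d n)%R).
  assert (Hcoef : forall n, (1 <= n)%nat ->
     (Cmod (u n * RtoC (/ INR n ^ s)) * (c * Rpower (INR n) e) <= w n)%R).
  { intros n Hn. assert (Hn1 := INR_ge_1 n Hn).
    rewrite Cmod_mult, Cmod_R, Rabs_pos_eq
      by (apply Rlt_le, Rinv_0_lt_compat, pow_lt; lra).
    rewrite <- Rpower_pow, <- Rpower_Ropp by lra.
    apply Rle_trans with (cu * Rpower (INR n) a * Rpower (INR n) (- INR s)
                          * (c * Rpower (INR n) e))%R.
    - apply Rmult_le_compat_r.
      + apply Rmult_le_pos; [trivial | apply Rlt_le, Rpower_pos].
      + apply Rmult_le_compat_r; [apply Rlt_le, Rpower_pos | now apply Hu].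
    - replace (cu * Rpower (INR n) a * Rpower (INR n) (- INR s) * (c * Rpower (INR n) e))%R
        with (cu * c * (Rpower (INR n) a * Rpower (INR n) e
                        * Rpower (INR n) (- INR s)))%R by ring.
      rewrite <- !Rpower_plus. unfold w, weight.
      destruct (Nat.eqb_spec n 0); [lia|].
      apply Rmult_le_compat_l; [now apply Rmult_le_pos|].
      apply Rle_Rpower; lra. }
  assert (Hw : bounded_sums w).
  { apply bounded_sums_le with (weight d) (cu * c)%R.
    - now apply Rmult_le_pos.
    - intros k _. apply Rle_refl.
    - now apply weight_bounded_sums. }
  assert (Hsum : forall n, (1 <= n)%nat ->
            has_sum (fun x => v x * RtoC (kappa n x)) (kernel_sum v kappa n)).
  { intros n Hn. now apply has_kernel_sum with b e. }
  destruct (has_sum_dominated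
     (fun n => u n * RtoC (/ INR n ^ s) * kernel_sum v kappa n) w) as [l Hl]; trivial.
  { intros n Hn. eapply Rle_trans; [|now apply Hcoef].
    rewrite Cmod_mult. apply Rmult_le_compat_l; [apply Cmod_ge_0|].
    eapply Clim_bound; [|now apply Hsum]. intros K.
    eapply Rle_trans; [apply Cmod_sum1 | now apply Hrow]. }
  exists l. split; trivial.
  apply Clim_ext with (fun K => sum1 (fun n => sum1 (fun x =>
     u n * RtoC (/ INR n ^ s) * (v x * RtoC (kappa n x))) K) K).
  { intros K. apply sum1_ext; intros n _. apply sum1_ext; intros x _.
    rewrite RtoC_mult. ring. }
  apply square_sums_limit with
    (fun n => u n * RtoC (/ INR n ^ s) * kernel_sum v kappa n) w; trivial.
  - intros n Hn. now apply has_sum_scal, Hsum.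
  - intros n K Hn. eapply Rle_trans; [|now apply Hcoef].
    rewrite (Rsum1_ext _ (fun x => Cmod (u n * RtoC (/ INR n ^ s)) *
                           Cmod (v x * RtoC (kappa n x)))%R)
      by (intros; apply Cmod_mult).
    rewrite Rsum1_mult_l. apply Rmult_le_compat_l; [apply Cmod_ge_0|].
    now apply Hrow.
Qed.

Lemma has_sum_power_bounded (u : nat -> C) (a d : R) (s : nat) :
  power_bounded u a -> (0 < d)%R -> (a - INR s <= - 1 - d)%R ->
  exists l, has_sum (fun n => u n * RtoC (/ INR n ^ s)) l.
Proof.
  intros [c [Hc Hu]] Hd Has.
  apply has_sum_dominated with (fun n => (c * weight d n)%R).
  - intros n Hn. assert (Hn1 := INR_ge_1 n Hn).
    rewrite Cmod_mult, Cmod_R, Rabs_pos_eq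
      by (apply Rlt_le, Rinv_0_lt_compat, pow_lt; lra).
    rewrite <- Rpower_pow, <- Rpower_Ropp by lra.
    apply Rle_trans with (c * Rpower (INR n) a * Rpower (INR n) (- INR s))%R.
    + apply Rmult_le_compat_r; [apply Rlt_le, Rpower_pos | now apply Hu].
    + rewrite Rmult_assoc, <- Rpower_plus. apply Rmult_le_compat_l; trivial.
      unfold weight. destruct (Nat.eqb_spec n 0); [lia|].
      apply Rle_Rpower; lra.
  - apply bounded_sums_le with (weight d) c; trivial.
    + intros k _. apply Rle_refl.
    + now apply weight_bounded_sums.
Qed.

(** * The sums of the statement in terms of kernels *)

Definition nonneg_part (a : Z -> C) (n : nat) : C := a (Z.of_nat n).

Lemma Cdiv_Cpown (z : C) (n j : nat) :
  (1 <= n)%nat -> z / Cpown n j = z * RtoC (/ INR n ^ j).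
Proof.
  intros Hn. unfold Cpown, Cdiv. rewrite RtoC_inv, RtoC_pow; trivial.
  apply pow_nonzero, INR_neq_0, Hn.
Qed.

Lemma Csign_RtoC (n : nat) : Csign n = RtoC ((-1) ^ n).
Proof. unfold Csign. now rewrite RtoC_pow. Qed.

Lemma Csign_sqr (n : nat) : Csign n * Csign n = 1.
Proof. now rewrite Csign_RtoC, <- RtoC_mult, pow_m1_sqr. Qed.

Lemma sum1_first (u : nat -> C) (n : nat) :
  sum1 u (S n) = u 1%nat + sum1 (fun k => u (S k)) n.
Proof.
  rewrite sum_Sn_m by lia. now rewrite <- sum_n_m_S.
Qed.

Lemma sum1_rev (h : nat -> C) (n : nat) :
  sum1 (fun k => h (S n - k)%nat) n = sum1 h n.
Proof.
  induction n as [|n IH]; [now rewrite !sum1_0|].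
  rewrite sum1_first, sum1_S, Cplus_comm, <- IH. f_equal.
Qed.

Lemma Rpower_neg_lim (d : R) : (0 < d)%R ->
  is_lim_seq (fun n => Rpower (INR (S n)) (- d)) 0.
Proof.
  intros Hd. apply is_lim_seq_spec. intros eps.
  assert (He : (0 < eps / 2)%R) by (destruct eps; simpl; lra).
  (* The threshold solves [x ^ (- d) = eps / 2]; halving [eps] yields the strict inequality. *)
  destruct (archimed (Rpower (eps / 2) (- / d))) as [HN _].
  set (z := up (Rpower (eps / 2) (- / d))) in *.
  assert (P := Rpower_pos (eps / 2) (- / d)).
  assert (Hz : (0 <= z)%Z) by (apply le_IZR; lra).
  exists (Z.to_nat z). intros n Hn.
  assert (Hn' : (Rpower (eps / 2) (- / d) <= INR (S n))%R).
  { rewrite S_INR. apply le_INR in Hn. rewrite INR_IZR_INZ, Z2Nat.id in Hn by trivial.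
    lra. }
  rewrite Rminus_0_r, Rabs_pos_eq by apply Rlt_le, Rpower_pos.
  apply Rle_lt_trans with (eps / 2)%R; [|lra].
  apply (conj P) in Hn'. apply (Rpower_le_neg _ _ (- d)) in Hn'; [|lra].
  rewrite Rpower_mult in Hn'.
  replace (- / d * - d)%R with 1%R in Hn' by (field; lra).
  rewrite Rpower_1 in Hn' by trivial. exact Hn'.
Qed.

Lemma power_bounded_div_lim (v : nat -> C) (e : R) :
  power_bounded v e -> (e < 1)%R -> Clim (fun n => v n * RtoC (/ INR n)) 0.
Proof.
  intros [c [Hc Hv]] He. apply (Clim_shift _ _ 1).
  apply Clim_squeeze with (fun n => (c * Rpower (INR (S n)) (- (1 - e)))%R).
  - intros n. rewrite Nat.add_1_r. specialize (Hv (S n) ltac:(lia)).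
    assert (H1 := INR_ge_1 (S n) ltac:(lia)).
    replace (v (S n) * RtoC (/ INR (S n)) - 0) with (v (S n) * RtoC (/ INR (S n)))
      by ring.
    replace (- (1 - e))%R with (e - 1)%R by ring. rewrite Rpower_m1 by lra.
    assert (0 < / INR (S n))%R by (apply Rinv_0_lt_compat; lra).
    rewrite Cmod_mult, Cmod_R, Rabs_pos_eq by lra.
    unfold Rdiv. rewrite <- Rmult_assoc. apply Rmult_le_compat_r; lra.
  - replace (Finite 0) with (Finite (c * 0)) by (f_equal; ring).
    apply is_lim_seq_mult'; [apply is_lim_seq_const|].
    apply Rpower_neg_lim. lra.
Qed.

(** The window has a fixed number [n] of terms, each tending to 0. *)
Lemma window_sum_lim (u : nat -> C) (n : nat) :
  Clim u 0 -> Clim (fun K => sum1 u (K + n) - sum1 u K) 0.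
Proof.
  intros Hu. induction n as [|n IH].
  - apply Clim_ext with (fun _ => 0); [|apply Clim_const].
    intros K. rewrite Nat.add_0_r. ring.
  - apply Clim_ext with (fun K => (sum1 u (K + n) - sum1 u K) + u (K + S n)%nat).
    + intros K. rewrite Nat.add_succ_r, sum1_S. ring.
    + replace (RtoC 0) with (0 + 0) by ring. apply Clim_plus; trivial.
      now apply (Clim_shift u).
Qed.

(* Boundary terms left over when [F_n(1)] and [Fbar_n(1)] are summed by shifting
   the index in only one of the two parts of their summands. *)
Definition window_correction (v : nat -> C) (n p K : nat) : C :=
  if Nat.eqb p 1
  then sum1 (fun x => v x * RtoC (/ INR x)) (K + n)
       - sum1 (fun x => v x * RtoC (/ INR x)) K
  else 0.

Lemma window_correction_lim (v : nat -> C) (n p : nat) (e : R) :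
  power_bounded v e -> (e < 1)%R -> Clim (window_correction v n p) 0.
Proof.
  intros Hv He. unfold window_correction. destruct (Nat.eqb p 1).
  - apply window_sum_lim. now apply power_bounded_div_lim with e.
  - apply Clim_const.
Qed.

(** Substitute [x = n - k]; the last term [k = n] is the one with [b 0]. *)
Lemma Esum_eq (b : Z -> C) (n p : nat) : (1 <= n)%nat ->
  Esum b n p = b 0%Z * RtoC (/ INR n ^ p)
    + sum1 (fun x => nonneg_part b x * RtoC (/ (INR n - INR x) ^ p)) (n - 1).
Proof.
  intros Hn. destruct n as [|n]; [lia|]. unfold Esum.
  replace (S n - 1)%nat with n by lia.
  rewrite sum1_S, Z.sub_diag, Cdiv_Cpown by lia.
  rewrite Cplus_comm. f_equal.
  rewrite <- (sum1_rev (fun x => nonneg_part b x * _)).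
  apply sum1_ext. intros k Hk. unfold nonneg_part. rewrite Cdiv_Cpown by lia.
  rewrite (minus_INR (S n) k) by lia. rewrite Nat2Z.inj_sub by lia.
  do 4 f_equal. ring.
Qed.

(** Substituting [x = n + k] gives [(n - x) ^ p = (- k) ^ p], whence the sign, and covers [x > n];
    the subtracted sum is the part [x < n], supplied by [Esum]. For [p = 1] the subtracted terms
    stop at [K] while the kernel sum runs to [K + n], which leaves the window. *)
Lemma Fterm_partial_sum (b : Z -> C) (n p K : nat) :
  (1 <= n)%nat -> (1 <= p)%nat ->
  sum1 (fun k => Csign p * Fterm b n p k) K =
  sum1 (fun x => nonneg_part b x * RtoC (kernel_minus p n x)) (K + n)
  - sum1 (fun x => nonneg_part b x * RtoC (/ (INR n - INR x) ^ p)) (n - 1)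
  - window_correction (nonneg_part b) n p K.
Proof.
  intros Hn Hp. set (v := nonneg_part b).
  induction K as [|K IH].
  - rewrite sum1_0. unfold window_correction. rewrite sum1_0, Nat.add_0_l.
    assert (E : forall N, (N <= n - 1)%nat ->
       sum1 (fun x => v x * RtoC (kernel_minus p n x)) N =
       sum1 (fun x => v x * RtoC (/ (INR n - INR x) ^ p)) N
       + (if Nat.eqb p 1 then sum1 (fun x => v x * RtoC (/ INR x)) N else 0)).
    { induction N as [|N IHN]; intros HN.
      - rewrite !sum1_0. destruct (Nat.eqb p 1); ring.
      - rewrite !sum1_S, IHN by lia. unfold kernel_minus.
        destruct (Nat.eqb_spec n (S N)); [lia|].
        rewrite RtoC_plus. destruct (Nat.eqb p 1); ring. }
    destruct n as [|n]; [lia|]. rewrite sum1_S.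
    replace (S n - 1)%nat with n in * by lia. rewrite E by lia.
    unfold kernel_minus. rewrite Nat.eqb_refl, Rplus_0_l.
    destruct (Nat.eqb p 1); rewrite ?sum1_S; ring.
  - rewrite sum1_S, IH, Nat.add_succ_l, sum1_S.
    assert (E : window_correction v n p (S K) = window_correction v n p K
       + (if Nat.eqb p 1 then v (S (K + n)) * RtoC (/ INR (S (K + n)))
                              - v (S K) * RtoC (/ INR (S K)) else 0)).
    { unfold window_correction. destruct (Nat.eqb p 1); [|ring].
      rewrite Nat.add_succ_l, !sum1_S. ring. }
    rewrite E. unfold kernel_minus, Fterm.
    destruct (Nat.eqb_spec n (S (K + n))); [lia|].
    replace (INR n - INR (S (K + n)))%R with (-1 * INR (S K))%R
      by (rewrite !S_INR, plus_INR; ring).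
    rewrite Rpow_mult_distr, Rinv_mult, <- pow_inv.
    replace (/ -1)%R with (-1)%R by lra.
    rewrite !Cdiv_Cpown, RtoC_plus, RtoC_mult, <- Csign_RtoC by lia.
    rewrite <- Nat2Z.inj_add. change (b (Z.of_nat (S K + n))) with (v (S (K + n))).
    change (b (Z.of_nat (S K))) with (v (S K)).
    destruct (Nat.eqb_spec p 1) as [->|Ep]; [|ring].
    rewrite pow_1. unfold Csign. ring.
Qed.

(** The terms [k < n] read [b] at negative indices and form exactly the [Ebar] that [Mbar]
    subtracts; [k = n] gives [b 0], and [k = n + x] gives the kernel. *)
Lemma Fbarterm_partial_sum (b : Z -> C) (n p K : nat) :
  (1 <= n)%nat -> (1 <= p)%nat ->
  sum1 (Fbarterm b n p) (K + n) =
  Ebar b (n - 1) p + b 0%Z * RtoC (/ INR n ^ p)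
  + sum1 (fun x => nonneg_part b x * RtoC (kernel_plus p n x)) K
  - window_correction (nonneg_part b) n p K.
Proof.
  intros Hn Hp. set (v := nonneg_part b).
  induction K as [|K IH].
  - rewrite sum1_0. unfold window_correction. rewrite sum1_0, Nat.add_0_l.
    assert (E : forall N, (N <= n - 1)%nat ->
       sum1 (Fbarterm b n p) N =
       sum1 (fun k => b (Z.of_nat k - Z.of_nat (n - 1) - 1)%Z / Cpown k p) N
       - (if Nat.eqb p 1 then sum1 (fun x => v x * RtoC (/ INR x)) N else 0)).
    { induction N as [|N IHN]; intros HN.
      - rewrite !sum1_0. destruct (Nat.eqb p 1); ring.
      - rewrite !sum1_S, IHN by lia. unfold Fbarterm.
        rewrite !Cdiv_Cpown by lia. rewrite pow_1.
        replace (Z.of_nat (S N) - Z.of_nat (n - 1) - 1)%Z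
          with (Z.of_nat (S N) - Z.of_nat n)%Z by lia.
        change (b (Z.of_nat (S N))) with (v (S N)).
        destruct (Nat.eqb_spec p 1) as [->|]; rewrite ?pow_1; ring. }
    destruct n as [|n]; [lia|]. rewrite sum1_S.
    replace (S n - 1)%nat with n in * by lia. rewrite E by lia.
    unfold Ebar, Fbarterm. rewrite Z.sub_diag, !Cdiv_Cpown, pow_1 by lia.
    change (b (Z.of_nat (S n))) with (v (S n)).
    destruct (Nat.eqb_spec p 1) as [->|]; rewrite ?sum1_S, ?pow_1; ring.
  - rewrite Nat.add_succ_l, !sum1_S, IH.
    assert (E : window_correction v n p (S K) = window_correction v n p K
       + (if Nat.eqb p 1 then v (S (K + n)) * RtoC (/ INR (S (K + n)))
                              - v (S K) * RtoC (/ INR (S K)) else 0)).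
    { unfold window_correction. destruct (Nat.eqb p 1); [|ring].
      rewrite Nat.add_succ_l, !sum1_S. ring. }
    rewrite E. unfold kernel_plus, Fbarterm.
    replace (INR n + INR (S K))%R with (INR (S (K + n)))
      by (rewrite !S_INR, plus_INR; ring).
    replace (Z.of_nat (S (K + n)) - Z.of_nat n)%Z with (Z.of_nat (S K)) by lia.
    rewrite !Cdiv_Cpown, RtoC_minus by lia.
    change (b (Z.of_nat (S (K + n)))) with (v (S (K + n))).
    change (b (Z.of_nat (S K))) with (v (S K)).
    destruct (Nat.eqb_spec p 1) as [->|Ep]; rewrite ?pow_1; ring.
Qed.

Lemma Fterm_has_sum (b : Z -> C) (n p : nat) (e d : R) :
  power_bounded (nonneg_part b) e -> (0 < e)%R -> (0 < d)%R -> (e + d < 1)%R ->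
  (1 <= n)%nat -> (1 <= p)%nat ->
  has_sum (Fterm b n p)
    (Csign p * (kernel_sum (nonneg_part b) (kernel_minus p) n
     - sum1 (fun x => nonneg_part b x * RtoC (/ (INR n - INR x) ^ p)) (n - 1))).
Proof.
  intros Hb He Hd Hed Hn Hp.
  apply has_sum_ext with (fun k => Csign p * (Csign p * Fterm b n p k)).
  { intros k _. rewrite Cmult_assoc, Csign_sqr. ring. }
  apply has_sum_scal.
  assert (HK := has_kernel_sum _ _ _ _ n Hb (tame_kernel_minus p e d Hp He Hd Hed) Hn).
  apply (Clim_shift _ _ n) in HK.
  assert (HW := window_correction_lim _ n p e Hb ltac:(lra)).
  match goal with |- has_sum _ ?l => replace l with (l - 0) by ring end.
  eapply Clim_ext; [|exact (Clim_minus _ _ _ _ (Clim_minus _ _ _ _ HK (Clim_const _)) HW)].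
  intros K. symmetry. now apply Fterm_partial_sum.
Qed.

Lemma Fbarterm_has_sum (b : Z -> C) (n p : nat) (e d : R) :
  power_bounded (nonneg_part b) e -> (0 < e)%R -> (0 < d)%R -> (e + d < 1)%R ->
  (1 <= n)%nat -> (1 <= p)%nat ->
  has_sum (Fbarterm b n p)
    (Ebar b (n - 1) p + b 0%Z * RtoC (/ INR n ^ p)
     + kernel_sum (nonneg_part b) (kernel_plus p) n).
Proof.
  intros Hb He Hd Hed Hn Hp.
  assert (HK := has_kernel_sum _ _ _ _ n Hb (tame_kernel_plus p e d Hp He Hd Hed) Hn).
  assert (HW := window_correction_lim _ n p e Hb ltac:(lra)).
  apply (Clim_shift _ _ n).
  match goal with |- Clim _ ?l => replace l with (l - 0) by ring end.
  eapply Clim_ext;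
    [|exact (Clim_minus _ _ _ _ (Clim_plus _ _ _ _ (Clim_const _) HK) HW)].
  intros K. symmetry. now apply Fbarterm_partial_sum.
Qed.

Lemma Msum_eq (b : Z -> C) (n p : nat) (e d : R) :
  power_bounded (nonneg_part b) e -> (0 < e)%R -> (0 < d)%R -> (e + d < 1)%R ->
  (1 <= n)%nat -> (1 <= p)%nat ->
  Msum b n p = b 0%Z * RtoC (/ INR n ^ p)
               + kernel_sum (nonneg_part b) (kernel_minus p) n.
Proof.
  intros Hb He Hd Hed Hn Hp. unfold Msum, Fsum.
  rewrite (has_sum_Cseries1 _ _ (Fterm_has_sum b n p e d Hb He Hd Hed Hn Hp)).
  rewrite Esum_eq, Cmult_assoc, Csign_sqr by trivial. ring.
Qed.

Lemma Mbar_eq (b : Z -> C) (n p : nat) (e d : R) :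
  power_bounded (nonneg_part b) e -> (0 < e)%R -> (0 < d)%R -> (e + d < 1)%R ->
  (1 <= n)%nat -> (1 <= p)%nat ->
  Mbar b n p = b 0%Z * RtoC (/ INR n ^ p)
               + kernel_sum (nonneg_part b) (kernel_plus p) n.
Proof.
  intros Hb He Hd Hed Hn Hp. unfold Mbar, Fbar.
  rewrite (has_sum_Cseries1 _ _ (Fbarterm_has_sum b n p e d Hb He Hd Hed Hn Hp)).
  ring.
Qed.

Lemma Rsum_eq (a : Z -> C) (n j : nat) : (1 <= n)%nat ->
  Rsum a n j = Msum a n j + Mbar a n j - a 0%Z * RtoC (/ INR n ^ j).
Proof.
  intros Hn. unfold Rsum, Gsum, Lsum, Msum, Mbar.
  destruct (Nat.eqb_spec n 0); [lia|]. rewrite Cdiv_Cpown by trivial.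
  rewrite Cmult_plus_distr_l, Cmult_assoc, Csign_sqr. ring.
Qed.

Lemma Dterm_has_sum (a : Z -> C) (e d : R) (s : nat) :
  power_bounded (nonneg_part a) e -> (0 < d)%R -> (e - INR s <= - 1 - d)%R ->
  has_sum (Dterm a s) (Cseries1 (Dterm a s)).
Proof.
  intros Ha Hd Hs. destruct (has_sum_power_bounded _ e d s Ha Hd Hs) as [l Hl].
  apply has_sum_ext with (v := Dterm a s) in Hl.
  - now rewrite (has_sum_Cseries1 _ _ Hl).
  - intros n Hn. unfold Dterm. now rewrite Cdiv_Cpown.
Qed.

Lemma INR_ge_2 (s : nat) : (2 <= s)%nat -> (2 <= INR s)%R.
Proof. intros H. now apply (le_INR 2). Qed.

Lemma has_sum_zero : has_sum (fun _ => RtoC 0) 0.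
Proof.
  apply Clim_ext with (fun _ => RtoC 0); [|apply Clim_const].
  intros K. induction K as [|K IH]; [now rewrite sum1_0|].
  rewrite sum1_S, <- IH. ring.
Qed.

Lemma sums_defined_power_bounded (a : Z -> C) (e d : R) :
  power_bounded (nonneg_part a) e -> (0 < e)%R -> (0 < d)%R -> (e + d < 1)%R ->
  sums_defined a.
Proof.
  intros Ha He Hd Hed.
  assert (HD : forall j, (1 < j)%nat -> cv_series1 (Dterm a j)).
  { intros j Hj. eapply has_sum_cv, Dterm_has_sum; [exact Ha|exact Hd|].
    assert (H := INR_ge_2 j Hj). lra. }
  (* The kernel representation needs [n >= 1]. For [n = 0] the terms vanish when [j = 1] and are
     those of [Dterm] otherwise. *)
  split; trivial. intros n j Hj. destruct n as [|n].
  - destruct (Nat.eq_dec j 1) as [->|Ej].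
    + assert (E : forall k z, (a k - a k) / z = 0)
        by (intros; unfold Cdiv; ring).
      split; apply has_sum_cv with (RtoC 0); apply (fun H => has_sum_ext _ _ _ H has_sum_zero);
        intros k _.
      * unfold Fterm. simpl. now rewrite Z.add_0_r, E.
      * unfold Fbarterm. simpl. now rewrite Z.sub_0_r, E.
    + destruct (HD j ltac:(lia)) as [l Hl]. apply has_sum_is_series in Hl.
      split; apply has_sum_cv with l; revert Hl; apply has_sum_ext; intros k _;
        unfold Fterm, Fbarterm, Dterm; destruct (Nat.eqb_spec j 1); try lia;
        do 2 f_equal; simpl; ring.
  - split; eapply has_sum_cv.
    + now apply Fterm_has_sum with e d; trivial; lia.
    + now apply Fbarterm_has_sum with e d; trivial; lia.
Qed.

(** * The bilinear identity in the limit *)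

(** Parametrized by the coefficient matrix [f], so that a linear relation between double sums at a
    fixed [K] reduces to a pointwise identity between matrices. *)
Definition bilinear_sum (u v : nat -> C) (f : nat -> nat -> R) (K : nat) : C :=
  sum1 (fun k => sum1 (fun m => u k * v m * RtoC (f k m)) K) K.

Lemma bilinear_sum_ext (u v : nat -> C) (f g : nat -> nat -> R) (K : nat) :
  (forall k m, (1 <= k)%nat -> (1 <= m)%nat -> f k m = g k m) ->
  bilinear_sum u v f K = bilinear_sum u v g K.
Proof.
  intros H. apply sum1_ext. intros k Hk. apply sum1_ext. intros m Hm.
  now rewrite H by lia.
Qed.

Lemma bilinear_sum_plus (u v : nat -> C) (f g : nat -> nat -> R) (K : nat) :
  bilinear_sum u v f K + bilinear_sum u v g K =
  bilinear_sum u v (fun k m => f k m + g k m)%R K.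
Proof.
  unfold bilinear_sum. rewrite <- sum1_plus. apply sum1_ext. intros k _.
  rewrite <- sum1_plus. apply sum1_ext. intros m _. rewrite RtoC_plus. ring.
Qed.

Lemma bilinear_sum_scal (u v : nat -> C) (c : R) (f : nat -> nat -> R) (K : nat) :
  RtoC c * bilinear_sum u v f K = bilinear_sum u v (fun k m => c * f k m)%R K.
Proof.
  unfold bilinear_sum. rewrite <- sum1_mult_l. apply sum1_ext. intros k _.
  rewrite <- sum1_mult_l. apply sum1_ext. intros m _. rewrite RtoC_mult. ring.
Qed.

Lemma bilinear_sum_sum (u v : nat -> C) (f : nat -> nat -> nat -> R) (p K : nat) :
  sum1 (fun j => bilinear_sum u v (f j) K) p =
  bilinear_sum u v (fun k m => Rsum1 (fun j => f j k m) p) K.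
Proof.
  unfold bilinear_sum. rewrite sum1_swap. apply sum1_ext. intros k _.
  rewrite sum1_swap. apply sum1_ext. intros m _.
  now rewrite sum1_mult_l, RtoC_sum1.
Qed.

Lemma bilinear_sum_flip (u v : nat -> C) (f : nat -> nat -> R) (K : nat) :
  bilinear_sum v u f K = bilinear_sum u v (fun k m => f m k) K.
Proof.
  unfold bilinear_sum. rewrite sum1_swap.
  apply sum1_ext. intros k _. apply sum1_ext. intros m _. ring.
Qed.

Lemma bilinear_sum_product (u v : nat -> C) (f g : nat -> R) (K : nat) :
  bilinear_sum u v (fun k m => f k * g m)%R K =
  sum1 (fun k => u k * RtoC (f k)) K * sum1 (fun m => v m * RtoC (g m)) K.
Proof.
  unfold bilinear_sum. rewrite Cmult_comm, <- sum1_mult_l.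
  apply sum1_ext. intros k _. rewrite Cmult_comm, <- sum1_mult_l.
  apply sum1_ext. intros m _. rewrite RtoC_mult. ring.
Qed.

Lemma bilinear_sum_diagonal (u v : nat -> C) (f : nat -> R) (K : nat) :
  bilinear_sum u v (fun k m => if Nat.eqb k m then f k else 0%R) K =
  sum1 (fun k => u k * v k * RtoC (f k)) K.
Proof.
  apply sum1_ext. intros k [Hk HK].
  assert (E : forall N, sum1 (fun m => u k * v m * RtoC (if Nat.eqb k m then f k else 0%R)) N
     = if Nat.leb k N then u k * v k * RtoC (f k) else 0).
  { induction N as [|N IH].
    - rewrite sum1_0. now destruct k; [lia|].
    - rewrite sum1_S, IH.
      destruct (Nat.eqb_spec k (S N)), (Nat.leb_spec k N), (Nat.leb_spec k (S N));
        subst; try lia; ring. }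
  rewrite E. now destruct (Nat.leb_spec k K); [|lia].
Qed.

Lemma tame_kernel_add (b e : R) (kappa lambda : nat -> nat -> R) :
  tame_kernel b e kappa -> tame_kernel b e lambda ->
  tame_kernel b e (fun n x => kappa n x + lambda n x)%R.
Proof.
  intros [c [Hc H]] [c' [Hc' H']]. exists (c + c')%R. split; [lra|].
  intros n K Hn. specialize (H n K Hn). specialize (H' n K Hn).
  rewrite Rmult_plus_distr_r. apply Rle_trans with (2 := Rplus_le_compat _ _ _ _ H H').
  rewrite <- Rsum1_plus. apply Rsum1_le. intros x _. rewrite <- Rmult_plus_distr_l.
  apply Rmult_le_compat_l; [apply Rlt_le, Rpower_pos | apply Rabs_triang].
Qed.

Lemma kernel_sum_add (v : nat -> C) (b e : R) (kappa lambda : nat -> nat -> R)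
    (n : nat) :
  power_bounded v b -> tame_kernel b e kappa -> tame_kernel b e lambda ->
  (1 <= n)%nat ->
  kernel_sum v (fun n x => kappa n x + lambda n x)%R n =
  kernel_sum v kappa n + kernel_sum v lambda n.
Proof.
  intros Hv Hk Hl Hn. apply has_sum_Cseries1.
  apply has_sum_ext with
    (fun x => v x * RtoC (kappa n x) + v x * RtoC (lambda n x)).
  - intros x _. rewrite RtoC_plus. ring.
  - now apply has_sum_plus; apply has_kernel_sum with b e.
Qed.

Lemma kernel_series_square (u v : nat -> C) (a b e d : R) (s : nat)
    (kappa : nat -> nat -> R) :
  power_bounded u a -> power_bounded v b -> tame_kernel b e kappa ->
  (0 < d)%R -> (a + e - INR s <= - 1 - d)%R ->
  let t := fun n => u n * RtoC (/ INR n ^ s) * kernel_sum v kappa n in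
  has_sum t (Cseries1 t) /\
  Clim (bilinear_sum u v (fun n x => / INR n ^ s * kappa n x)%R) (Cseries1 t).
Proof.
  intros Hu Hv Hk Hd Hs t.
  destruct (kernel_double_series u v a b e d s kappa Hu Hv Hk Hd Hs) as [l [H1 H2]].
  fold t in H1. rewrite (has_sum_Cseries1 t l H1). split; assumption.
Qed.

Lemma power_bounded_mult (u v : nat -> C) (a b : R) :
  power_bounded u a -> power_bounded v b ->
  power_bounded (fun n => u n * v n) (a + b).
Proof.
  intros [c [Hc Hu]] [c' [Hc' Hv]]. exists (c * c')%R.
  split; [now apply Rmult_le_pos|]. intros n Hn. rewrite Cmod_mult, Rpower_plus.
  replace (c * c' * (Rpower (INR n) a * Rpower (INR n) b))%R
    with ((c * Rpower (INR n) a) * (c' * Rpower (INR n) b))%R by ring.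
  apply Rmult_le_compat; try apply Cmod_ge_0; auto.
Qed.

(** The kernel estimates need positive exponents, so [alpha] and [beta] are raised to at least
    [g / 4], where [g] is the smallest slack available. The loss [d] is paid twice, in the row bound
    and in the summability of the outer series, and [g / 8] leaves room for both. *)
Lemma choose_exponents (alpha beta Q : R) :
  (alpha < 1)%R -> (beta < 1)%R -> (alpha + beta < Q - 1)%R -> (2 <= Q)%R ->
  exists e f d : R, (alpha <= e /\ beta <= f /\ 0 < e /\ 0 < f /\ 0 < d /\
    e + d < 1 /\ f + d < 1 /\ e + f + d - Q <= - 1 - d)%R.
Proof.
  intros Ha Hb Hab HQ.
  set (g := Rmin (Rmin (1 - alpha) (1 - beta)) (Rmin (Q - 1 - alpha - beta) 1)).
  exists (Rmax alpha (g / 4)), (Rmax beta (g / 4)), (g / 8)%R.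
  assert (Hg : (0 < g)%R) by (unfold g; repeat apply Rmin_glb_lt; lra).
  assert (H1 := Rmin_l (1 - alpha) (1 - beta)).
  assert (H2 := Rmin_r (1 - alpha) (1 - beta)).
  assert (H3 := Rmin_l (Q - 1 - alpha - beta) 1).
  assert (H4 := Rmin_r (Q - 1 - alpha - beta) 1).
  assert (H5 := Rmin_l (Rmin (1 - alpha) (1 - beta)) (Rmin (Q - 1 - alpha - beta) 1)).
  assert (H6 := Rmin_r (Rmin (1 - alpha) (1 - beta)) (Rmin (Q - 1 - alpha - beta) 1)).
  fold g in H5, H6.
  unfold Rmax. destruct (Rle_dec alpha (g / 4)), (Rle_dec beta (g / 4)); lra.
Qed.

Lemma Cbinom_hockey_stick (p q : nat) : (1 <= p)%nat -> (1 <= q)%nat ->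
  sum1 (fun j => Cbinom (p + q - j - 1) (q - 1)) p = Cbinom (p + q - 1) q.
Proof.
  intros Hp Hq. unfold Cbinom. now rewrite <- RtoC_sum1, hockey_stick.
Qed.

Theorem theorem3p2 :
  forall (a b : Z -> C) (alpha beta : R) (p q : nat),
    (1 <= p)%nat -> (1 < q)%nat ->
    (alpha < 1)%R -> (beta < 1)%R ->
    (alpha + beta < INR q - 1)%R ->
    little_o_pow a alpha -> little_o_pow b beta ->
    (sums_defined a /\ sums_defined b /\
     cv_series1 (Dterm (fun k => a k * b k) (p + q)) /\
     cv_series1 (fun n => Mbar b n p / Cpown n q * a (Z.of_nat n)) /\
     cv_series1 (fun n => Msum b n p / Cpown n q * a (Z.of_nat n)) /\
     (forall j : nat, (1 <= j <= p)%nat ->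
        cv_series1 (fun n => Rsum a n j / Cpown n (p + q - j) * b (Z.of_nat n))))
    /\
    Csign (p + q) * Cseries1 (fun n => Mbar b n p / Cpown n q * a (Z.of_nat n))
    + Cseries1 (fun n => Msum b n p / Cpown n q * a (Z.of_nat n))
    =
    Csign p *
      sum_n_m (fun j => Cbinom (p + q - j - 1) (q - 1) *
        Cseries1 (fun n => Rsum a n j / Cpown n (p + q - j) * b (Z.of_nat n))) 1 p
    + Csign p * 2 *
      sum_n_m (fun j => Cbinom (p + q - 2 * j - 1) (p - 1) *
        Dsum a (2 * j) * Dsum b (p + q - 2 * j)) 1 (q / 2)
    + b 0%Z * (1 + Csign (p + q)) * Dsum a (p + q)
    - Csign p * a 0%Z * Cbinom (p + q - 1) q * Dsum b (p + q)
    - Csign p * Cbinom (p + q - 1) p * Dsum (fun k => a k * b k) (p + q).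
Proof.
  intros a b alpha beta p q Hp Hq Halpha Hbeta Hab Ha Hb.
  assert (HQ := INR_ge_2 q Hq).
  destruct (choose_exponents alpha beta (INR q) Halpha Hbeta Hab HQ)
    as (e & f & d & Hae & Hbf & He & Hf & Hd & Hed & Hfd & Hefd).
  set (u := nonneg_part a). set (v := nonneg_part b).
  assert (Hu : power_bounded u e)
    by (apply (little_o_pow_power_bounded a alpha); trivial; lra).
  assert (Hv : power_bounded v f)
    by (apply (little_o_pow_power_bounded b beta); trivial; lra).
  assert (HTa : forall j, (1 <= j)%nat ->
     tame_kernel e (e + d) (fun n x => kernel_plus j n x + kernel_minus j n x)%R).
  { intros j Hj. apply tame_kernel_add;
      [now apply tame_kernel_plus | now apply tame_kernel_minus]. }
  assert (HDa : forall s, (2 <= s)%nat -> has_sum (Dterm a s) (Cseries1 (Dterm a s))).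
  { intros s Hs. apply INR_ge_2 in Hs. apply Dterm_has_sum with e d; trivial. lra. }
  assert (HDb : forall s, (2 <= s)%nat -> has_sum (Dterm b s) (Cseries1 (Dterm b s))).
  { intros s Hs. apply INR_ge_2 in Hs. apply Dterm_has_sum with f d; trivial. lra. }
  assert (HDs : forall c s, (2 <= s)%nat -> Dsum c s = Cseries1 (Dterm c s)).
  { intros c s Hs. unfold Dsum. destruct (Nat.eqb_spec s 1); [lia | reflexivity]. }
  assert (HDab : has_sum (Dterm (fun k => a k * b k) (p + q))
                         (Cseries1 (Dterm (fun k => a k * b k) (p + q)))).
  { apply Dterm_has_sum with (e + f)%R d; trivial.
    - exact (power_bounded_mult u v e f Hu Hv).
    - rewrite plus_INR. assert (H := pos_INR p). lra. }
  destruct (kernel_series_square u v e f (f + d) d q (kernel_plus p) Hu Hv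
    (tame_kernel_plus p f d Hp Hf Hd Hfd) Hd ltac:(lra)) as [S1 L1].
  destruct (kernel_series_square u v e f (f + d) d q (kernel_minus p) Hu Hv
    (tame_kernel_minus p f d Hp Hf Hd Hfd) Hd ltac:(lra)) as [S2 L2].
  set (t1 := fun n => u n * RtoC (/ INR n ^ q) * kernel_sum v (kernel_plus p) n) in *.
  set (t2 := fun n => u n * RtoC (/ INR n ^ q) * kernel_sum v (kernel_minus p) n) in *.
  (* The roles are exchanged here: [b] is outside and [a] is summed against the kernels. Since
     [p + q - j >= q], the same exponents work. *)
  set (t3 := fun j n => v n * RtoC (/ INR n ^ (p + q - j)) *
     kernel_sum u (fun n x => kernel_plus j n x + kernel_minus j n x)%R n).
  assert (H3 : forall j, (1 <= j <= p)%nat ->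
     has_sum (t3 j) (Cseries1 (t3 j)) /\
     Clim (bilinear_sum v u (fun n x => / INR n ^ (p + q - j) *
             (kernel_plus j n x + kernel_minus j n x))%R) (Cseries1 (t3 j))).
  { intros j Hj. apply kernel_series_square with f e (e + d)%R d; trivial.
    - apply HTa. lia.
    - assert (INR q <= INR (p + q - j))%R by (apply le_INR; lia). lra. }
  assert (Hpow : forall n s t, RtoC (/ INR n ^ (s + t)) =
     RtoC (/ INR n ^ s) * RtoC (/ INR n ^ t)).
  { intros n s t. rewrite <- RtoC_mult. f_equal. rewrite pow_add. apply Rinv_mult. }
  assert (HM1 : has_sum (fun n => Mbar b n p / Cpown n q * a (Z.of_nat n))
     (b 0%Z * Cseries1 (Dterm a (p + q)) + Cseries1 t1)).
  { eapply has_sum_ext; [|apply has_sum_plus;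
      [apply has_sum_scal, (HDa (p + q)%nat); lia | exact S1]].
    intros n Hn. cbv beta. unfold t1, Dterm.
    rewrite !Cdiv_Cpown, (Mbar_eq b n p f d), Hpow by trivial.
    change (a (Z.of_nat n)) with (u n). fold v. ring. }
  assert (HM2 : has_sum (fun n => Msum b n p / Cpown n q * a (Z.of_nat n))
     (b 0%Z * Cseries1 (Dterm a (p + q)) + Cseries1 t2)).
  { eapply has_sum_ext; [|apply has_sum_plus;
      [apply has_sum_scal, (HDa (p + q)%nat); lia | exact S2]].
    intros n Hn. cbv beta. unfold t2, Dterm.
    rewrite !Cdiv_Cpown, (Msum_eq b n p f d), Hpow by trivial.
    change (a (Z.of_nat n)) with (u n). fold v. ring. }
  (* [Msum] and [Mbar] each contribute [a 0 / n ^ j] and [Rsum] removes one, so a single [a 0]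
     survives, multiplied by a series that does not depend on [j]. *)
  assert (HR : forall j, (1 <= j <= p)%nat ->
     has_sum (fun n => Rsum a n j / Cpown n (p + q - j) * b (Z.of_nat n))
       (a 0%Z * Cseries1 (Dterm b (p + q)) + Cseries1 (t3 j))).
  { intros j Hj. eapply has_sum_ext; [|apply has_sum_plus;
      [apply has_sum_scal, (HDb (p + q)%nat); lia | exact (proj1 (H3 j Hj))]].
    intros n Hn. cbv beta. unfold t3, Dterm.
    rewrite (kernel_sum_add u e (e + d)) by
      (trivial; try (apply tame_kernel_plus || apply tame_kernel_minus);
       trivial; lia).
    rewrite !Cdiv_Cpown, Rsum_eq, (Msum_eq a n j e d), (Mbar_eq a n j e d)
      by (trivial; lia).
    replace (p + q)%nat with (p + q - j + j)%nat at 1 by lia. rewrite Hpow.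
    change (b (Z.of_nat n)) with (v n). fold u. ring. }
  split.
  { repeat split.
    - exact (proj1 (sums_defined_power_bounded a e d Hu He Hd Hed)).
    - now apply (proj2 (sums_defined_power_bounded a e d Hu He Hd Hed)).
    - now apply (proj2 (sums_defined_power_bounded a e d Hu He Hd Hed)).
    - exact (proj1 (sums_defined_power_bounded b f d Hv Hf Hd Hfd)).
    - now apply (proj2 (sums_defined_power_bounded b f d Hv Hf Hd Hfd)).
    - now apply (proj2 (sums_defined_power_bounded b f d Hv Hf Hd Hfd)).
    - exact (has_sum_cv _ _ HDab).
    - exact (has_sum_cv _ _ HM1).
    - exact (has_sum_cv _ _ HM2).
    - intros j Hj. exact (has_sum_cv _ _ (HR j Hj)). }
  rewrite (has_sum_Cseries1 _ _ HM1), (has_sum_Cseries1 _ _ HM2).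
  rewrite !(HDs _ (p + q)%nat) by lia.
  set (DA := Cseries1 (Dterm a (p + q))). set (DB := Cseries1 (Dterm b (p + q))).
  set (DAB := Cseries1 (Dterm (fun k => a k * b k) (p + q))) in *.
  rewrite (sum1_ext _ (fun j => a 0%Z * DB * Cbinom (p + q - j - 1) (q - 1)
     + Cbinom (p + q - j - 1) (q - 1) * Cseries1 (t3 j))).
  2:{ intros j Hj. rewrite (has_sum_Cseries1 _ _ (HR j Hj)). fold DB. ring. }
  (* The hockey-stick sum makes the [a 0] part cancel the explicit [a 0] term of the statement. With
     the [b 0] terms matched as well, only the indices [k, m >= 1] remain in [Hmain]. *)
  rewrite sum1_plus, sum1_mult_l, Cbinom_hockey_stick by lia.
  assert (Hmain : Csign (p + q) * Cseries1 t1 + Cseries1 t2 =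
     Csign p * sum1 (fun j => Cbinom (p + q - j - 1) (q - 1) * Cseries1 (t3 j)) p
     + Csign p * 2 * sum1 (fun j => Cbinom (p + q - 2 * j - 1) (p - 1) *
          Dsum a (2 * j) * Dsum b (p + q - 2 * j)) (q / 2)
     - Csign p * Cbinom (p + q - 1) p * DAB).
  2:{ set (X := sum1 (fun j => Cbinom (p + q - 2 * j - 1) (p - 1) * _ * _) _) in *.
      set (Y := sum1 (fun j => _ * Cseries1 (t3 j)) p) in *.
      transitivity (b 0%Z * (1 + Csign (p + q)) * DA +
        (Csign (p + q) * Cseries1 t1 + Cseries1 t2)); [ring|].
      rewrite Hmain. ring. }
  assert (HDD : forall i, (1 <= i <= q / 2)%nat ->
     Clim (bilinear_sum u v (fun k m =>
             if Nat.eqb (p + q - 2 * i) 1 then 0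
             else / INR k ^ (2 * i) * / INR m ^ (p + q - 2 * i))%R)
          (Dsum a (2 * i) * Dsum b (p + q - 2 * i))).
  { intros i Hi. assert (2 * (q / 2) <= q)%nat by (apply Nat.Div0.mul_div_le).
    destruct (Nat.eqb_spec (p + q - 2 * i) 1) as [E|E].
    - rewrite E. unfold Dsum at 2. simpl (1 =? 1)%nat. cbv iota. rewrite Cmult_0_r.
      apply Clim_ext with (fun K => RtoC 0 * bilinear_sum u v (fun _ _ => 0%R) K).
      + intros K. rewrite bilinear_sum_scal. apply bilinear_sum_ext.
        intros. ring.
      + apply Clim_ext with (fun _ => RtoC 0); [intros; ring | apply Clim_const].
    - rewrite !HDs by lia.
      eapply Clim_ext; [|apply Clim_mult; [apply (HDa (2 * i)%nat); lia
                                          |apply (HDb (p + q - 2 * i)%nat); lia]].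
      intros K. rewrite bilinear_sum_product.
      f_equal; apply sum1_ext; intros k Hk; unfold Dterm;
        now rewrite Cdiv_Cpown by lia. }
  assert (HLeft := Clim_plus _ _ _ _ (Clim_scal (Csign (p + q)) _ _ L1) L2).
  (* Both sides of [Hmain] are shown to be limits of the same square sums. *)
  eapply Clim_unique; [exact HLeft|].
  eapply Clim_ext; [|apply Clim_minus; [apply Clim_plus|]].
  2:{ apply Clim_scal. apply (Clim_sum1
        (fun j K => Cbinom (p + q - j - 1) (q - 1) *
           bilinear_sum v u (fun n x => / INR n ^ (p + q - j) *
             (kernel_plus j n x + kernel_minus j n x))%R K)).
      intros j Hj. now apply Clim_scal, H3. }
  2:{ apply Clim_scal. apply (Clim_sum1
        (fun i K => Cbinom (p + q - 2 * i - 1) (p - 1) *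
           bilinear_sum u v (fun k m =>
             if Nat.eqb (p + q - 2 * i) 1 then 0
             else / INR k ^ (2 * i) * / INR m ^ (p + q - 2 * i))%R K)).
      intros i Hi. rewrite <- Cmult_assoc. now apply Clim_scal, HDD. }
  2:{ apply Clim_scal. exact HDab. }
  intros K. cbv beta. symmetry.
  rewrite (sum1_ext (Dterm _ _) (fun k => u k * v k * RtoC (/ INR k ^ (p + q))))
    by (intros k Hk; unfold Dterm; now rewrite Cdiv_Cpown by lia).
  rewrite <- (bilinear_sum_diagonal u v (fun k => / INR k ^ (p + q))%R).
  (* The [t3] squares have the index of [b] outside; flipping them puts every term over the same
     pair [u], [v]. *)
  rewrite (sum1_ext _ (fun j => bilinear_sum u v (fun k m =>
     Binomial.C (p + q - j - 1) (q - 1) * (/ INR m ^ (p + q - j) *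
       (kernel_plus j m k + kernel_minus j m k)))%R K))
    by (intros j _; unfold Cbinom; now rewrite bilinear_sum_flip, bilinear_sum_scal).
  rewrite (sum1_ext (fun i => Cbinom (p + q - 2 * i - 1) (p - 1) * _)
    (fun i => bilinear_sum u v (fun k m =>
     Binomial.C (p + q - 2 * i - 1) (p - 1) *
       (if Nat.eqb (p + q - 2 * i) 1 then 0
        else / INR k ^ (2 * i) * / INR m ^ (p + q - 2 * i)))%R K))
    by (intros j _; unfold Cbinom; now rewrite bilinear_sum_scal).
  rewrite !bilinear_sum_sum. unfold Cbinom, Cminus. rewrite !Csign_RtoC.
  rewrite <- !RtoC_mult.
  (* The sign is moved into the real scalar so that [bilinear_sum_scal] and [bilinear_sum_plus] can
     merge everything into one matrix. *)
  match goal with |- _ = _ + - (RtoC ?c * ?x) =>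
    replace (- (RtoC c * x)) with (RtoC (- c) * x) by (rewrite RtoC_opp; ring)
  end.
  rewrite !bilinear_sum_scal, !bilinear_sum_plus. apply bilinear_sum_ext.
  intros k m Hk Hm. rewrite kernel_identity by lia. ring.
Qed.
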